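(* Let $k$ be a commutative artinian ring and let $(\mathcal C,\mathbb E,\mathfrak s)$ be an $\mathrm{Ext}$-finite, Krull-Schmidt, $k$-linear $n$-exangulated category satisfying condition (WIC). Let $C$ be a non-projective indecomposable object of $\mathcal C$. The following statements are equivalent: (1) $C\in\mathcal C_r$. (2) For each $X_{n+1}\in\mathcal C$ and each right $\mathrm{End}_{\mathcal C}(C)$-submodule $H$ of $\mathcal C(C,X_{n+1})$ satisfying $\mathcal P(C,X_{n+1})\subseteq H$, there exists a distinguished $n$-exangle $X_0\to X_1\to X_2\to\cdots\to X_n\xrightarrow{\alpha}X_{n+1}\overset{\eta}{\dashrightarrow}$ where $\alpha$ is right $C$-determined such that $H=\mathrm{Im}\,\mathcal C(C,\alpha)$. (3) There exists an inflation $\alpha\colon X_0\to X_1$ whose intrinsic weak $n$-cokernel is $C$ such that $\alpha$ is left $K$-determined for some object $K$. (4) There exists an Auslander-Reiten $n$-exangle ending at $C$. (5) There exists a deflation which is not a split epimorphism and which is right $C$-determined. (6) There exist a deflation $\alpha\colon X_n\to X_{n+1}$ and a morphism $f\colon C\to X_{n+1}$ such that $f$ almost factors through $\alpha$.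
   Context: **$n$-exangulated categories.** Fix an integer $n\ge 1$. Let $\mathcal C$ be an additive category and $\mathbb E\colon\mathcal C^{\mathrm{op}}\times\mathcal C\to\mathrm{Ab}$ an additive bifunctor. An element $\delta\in\mathbb E(C,A)$ is an extension; for $a\colon A\to A'$, $c\colon C'\to C$ write $a_*\delta=\mathbb E(C,a)(\delta)$, $c^*\delta=\mathbb E(c,A)(\delta)$. A morphism of extensions from $\delta\in\mathbb E(C,A)$ to $\delta'\in\mathbb E(C',A')$ is a pair $(a\colon A\to A',\,c\colon C\to C')$ with $a_*\delta=c^*\delta'$. Consider complexes $X_\bullet\colon X_0\xrightarrow{d^X_0}X_1\to\cdots\to X_n\xrightarrow{d^X_n}X_{n+1}$ with chain maps $f_\bullet=(f_0,\dots,f_{n+1})$; for fixed end terms $X_0=A$, $X_{n+1}=C$, $[X_\bullet]$ denotes the homotopy equivalence class with respect to chain maps that are identities on both end terms. An $n$-exangle is a pair $\langle X_\bullet,\delta\rangle$ with $\delta\in\mathbb E(X_{n+1},X_0)$ such that the sequences of functors $\mathcal C(-,X_0)\to\cdots\to\mathcal C(-,X_{n+1})\to\mathbb E(-,X_0)$ (last map $f\mapsto f^*\delta$) and $\mathcal C(X_{n+1},-)\to\cdots\to\mathcal C(X_0,-)\to\mathbb E(X_{n+1},-)$ (last map $g\mapsto g_*\delta$) are exact. An exact realization $\mathfrak s$ assigns to each $\delta\in\mathbb E(C,A)$ a class $\mathfrak s(\delta)=[X_\bullet]$ with $X_0=A$, $X_{n+1}=C$ such that: (R0) if $\mathfrak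 s(\delta)=[X_\bullet]$, $\mathfrak s(\rho)=[Y_\bullet]$, each morphism of extensions $(a,c)\colon\delta\to\rho$ has a lift, i.e. a chain map $f_\bullet\colon X_\bullet\to Y_\bullet$ with $f_0=a$, $f_{n+1}=c$; (R1) if $\mathfrak s(\delta)=[X_\bullet]$ then $\langle X_\bullet,\delta\rangle$ is an $n$-exangle; (R2) $\mathfrak s$ of $0\in\mathbb E(0,A)$ is $[A\xrightarrow{\mathrm{id}}A\to0\to\cdots\to0]$ and of $0\in\mathbb E(A,0)$ is $[0\to\cdots\to0\to A\xrightarrow{\mathrm{id}}A]$. If $\mathfrak s(\delta)=[X_\bullet]$, then $\langle X_\bullet,\delta\rangle$ is a distinguished $n$-exangle, written $X_0\to\cdots\to X_{n+1}\overset{\delta}{\dashrightarrow}$ (starting at $X_0$, ending at $X_{n+1}$), $d_0^X$ is an inflation and $d_n^X$ is a deflation. The mapping cone $M^f_\bullet$ of $f_\bullet\colon X_\bullet\to Y_\bullet$ with $f_0=\mathrm{id}$ is $X_1\to X_2\oplus Y_1\to\cdots\to X_{n+1}\oplus Y_n\to Y_{n+1}$ with differentials $\begin{bmatrix}-d_1^X\\ f_1\end{bmatrix}$, $\begin{bmatrix}-d^X_{i+1}&0\\ f_{i+1}&d_i^Y\end{bmatrix}$ ($1\le i\le n-1$), $\begin{bmatrix}f_{n+1}&d_n^Y\end{bmatrix}$; mapping cocones of chain maps with $f_{n+1}=\mathrm{id}$ are defined dually. $(\mathcal C,\mathbb E,\mathfrak s)$ is $n$-exangulated if: (EA1) compositions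 of inflations are inflations and compositions of deflations are deflations; (EA2) for $\rho\in\mathbb E(D,A)$, $c\colon C\to D$ and distinguished $\langle X_\bullet,c^*\rho\rangle$, $\langle Y_\bullet,\rho\rangle$, the pair $(\mathrm{id}_A,c)$ has a lift $f_\bullet$ such that $\langle M^f_\bullet,(d_0^X)_*\rho\rangle$ is distinguished; (EA2$^{\mathrm{op}}$) the dual of (EA2). **Standing assumptions.** $k$-linear: $\mathcal C$ is $k$-linear and $\mathbb E$ is $k$-bilinear. $\mathrm{Ext}$-finite: every $\mathbb E(A,B)$ is a finitely generated $k$-module. Condition (WIC): for all $f\colon A\to B$, $g\colon B\to C$: if $gf$ is a deflation then so is $g$; if $gf$ is an inflation then so is $f$. **Stable categories.** An object $P$ is projective if for each distinguished $n$-exangle $A_0\to\cdots\to A_n\xrightarrow{\alpha_n}A_{n+1}\dashrightarrow$ every morphism $P\to A_{n+1}$ factors through $\alpha_n$. A morphism $f\colon X\to Y$ is $n$-projectively trivial if $\mathbb E(f,Z)\colon\mathbb E(Y,Z)\to\mathbb E(X,Z)$ is zero for all $Z$, and $n$-injectively trivial if $\mathbb E(Z,f)\colon\mathbb E(Z,X)\to\mathbb E(Z,Y)$ is zero for all $Z$. $\mathcal P(A,B)$ (resp. $\mathcal I(A,B)$) is the set of $n$-projectively (resp. $n$-injectively) trivial morphisms $A\to B$. $\overline{\mathcal C}$ has the objects of $\mathcal C$ and morphisms $\overline{\mathcal C}(A,B)=\mathcal C(A,B)/\mathcal I(A,B)$. Let $D=\mathrm{Hom}_k(-,\check k)$ with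 $\check k$ the minimal injective cogenerator of the category $k$-mod of finitely generated $k$-modules. $\mathcal C_r$ is the full subcategory of those $X\in\mathcal C$ for which the (contravariant) functor $D\mathbb E(X,-)\colon\overline{\mathcal C}\to k\text{-mod}$ is representable, i.e. isomorphic to $\overline{\mathcal C}(-,X')$ for some $X'$. **Auslander-Reiten $n$-exangles.** $\mathrm{rad}_{\mathcal C}$ is the Jacobson radical of $\mathcal C$. A morphism $\alpha\colon A\to B$ is right almost split if it is not a split epimorphism and every morphism $L\to B$ that is not a split epimorphism factors through $\alpha$; left almost split is dual. A distinguished $n$-exangle $A_0\xrightarrow{\alpha_0}A_1\to\cdots\to A_n\xrightarrow{\alpha_n}A_{n+1}\dashrightarrow$ is an Auslander-Reiten $n$-exangle if $\alpha_0$ is left almost split, $\alpha_n$ is right almost split and, when $n\ge2$, $\alpha_1,\dots,\alpha_{n-1}$ are in $\mathrm{rad}_{\mathcal C}$. **Determined morphisms.** $f\in\mathcal C(X,Y)$ is right $C$-determined if each $g\in\mathcal C(L,Y)$ such that $g\circ h$ factors through $f$ for every $h\in\mathcal C(C,L)$ itself factors through $f$. Dually, $f\in\mathcal C(X,Y)$ is left $K$-determined if each $g\in\mathcal C(X,L)$ such that $h\circ g$ factors through $f$ for every $h\in\mathcal C(L,K)$ itself factors through $f$. A morphism $g\colon Z\to Y$ almost factors through $f\colon X\to Y$ if $g$ does not factor through $f$, but $g\circ h$ factors through $f$ for every object $T$ and every $h\in\mathrm{rad}_{\mathcal C}(T,Z)$. **Intrinsic weak $n$-kernels and $n$-cokernels.**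 $f\colon X\to Y$ is right minimal if every $g\in\mathrm{End}(X)$ with $fg=f$ is an automorphism. Morphisms $f\colon X\to Y$, $f'\colon X'\to Y$ are right equivalent if each factors through the other; a right minimal version of $f$ is a right minimal $f'$ right equivalent to $f$ (it exists as $\mathcal C$ is Krull-Schmidt). If $f\colon X_n\to X_{n+1}$ is a deflation with right minimal version $f'\colon Z_n\to X_{n+1}$ and there is a distinguished $n$-exangle $Z_0\to Z_1\to\cdots\to Z_n\xrightarrow{f'}X_{n+1}\dashrightarrow$, then $Z_0$ is called an intrinsic weak $n$-kernel of $f$. Dually, if $f\colon X_0\to X_1$ is an inflation with left minimal version $f'\colon X_0\to Z_1$ and there is a distinguished $n$-exangle $X_0\xrightarrow{f'}Z_1\to\cdots\to Z_n\to Z_{n+1}\dashrightarrow$, then $Z_{n+1}$ is called an intrinsic weak $n$-cokernel of $f$.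
   Formalization: In (3) the inflation α is additionally required not to be a split monomorphism; this is automatic for n=1, while for n≥2 the exangle X_0=X_0→0→…→0→C=C would make (3) as written hold for every C, so the equivalence would fail. *)

(* Defs.v *)
From HB Require Import structures.
From mathcomp Require Import all_boot all_algebra.
From mathcomp Require Import boolp.

Set Implicit Arguments.
Unset Strict Implicit.
Unset Printing Implicit Defensive.

Import GRing.Theory.
Local Open Scope ring_scope.

Definition is_ideal (k : comPzRingType) (I : k -> Prop) : Prop :=
  [/\ I 0, forall x y, I x -> I y -> I (x + y) & forall a x, I x -> I (a * x)].

Definition artinian (k : comPzRingType) : Prop :=
  forall I : nat -> k -> Prop,
    (forall m, is_ideal (I m)) -> (forall m x, I m.+1 x -> I m x) ->
    exists m, forall p x, (m <= p)%N -> I m x -> I p x.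

Definition fin_gen (k : comPzRingType) (U : lmodType k) : Prop :=
  exists m (g : 'I_m -> U), forall x, exists c : 'I_m -> k,
    x = \sum_i c i *: g i.

Definition injective_in_kmod (k : comPzRingType) (J : lmodType k) : Prop :=
  forall U V : lmodType k, fin_gen U -> fin_gen V ->
  forall (i : {linear U -> V}) (f : {linear U -> J}), injective i ->
    exists g : {linear V -> J}, forall u, g (i u) = f u.

Definition cogenerator_in_kmod (k : comPzRingType) (J : lmodType k) : Prop :=
  forall U V : lmodType k, fin_gen U -> fin_gen V ->
  forall f g : {linear U -> V}, ~ (f =1 g) ->
    exists h : {linear V -> J}, ~ (h \o f =1 h \o g).

Definition injective_cogenerator (k : comPzRingType) (J : lmodType k) : Prop :=
  [/\ fin_gen J, injective_in_kmod J & cogenerator_in_kmod J].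

Definition minimal_injective_cogenerator (k : comPzRingType) (J : lmodType k) :
    Prop :=
  injective_cogenerator J /\
  forall J' : lmodType k, injective_cogenerator J' ->
    exists i : {linear J -> J'}, injective i.

Lemma linear_eq (k : comPzRingType) (U J : lmodType k) (f g : {linear U -> J}) :
  f =1 g -> f = g.
Proof.
case: f => f cf; case: g => g cg /= /funext fg.
case: _ / fg in cg *.
suff -> : cf = cg by [].
case: cf => -[a] [b]; case: cg => -[c] [d].
by rewrite (Prop_irrelevance a c) (Prop_irrelevance b d).
Qed.

Definition hom_mod (k : comPzRingType) (U J : lmodType k) : Type :=
  {linear U -> J}.

Section HomModule.
Variables (k : comPzRingType) (U J : lmodType k).

HB.instance Definition _ := gen_eqMixin (hom_mod U J).
HB.instance Definition _ := gen_choiceMixin (hom_mod U J).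

Definition hom_mod_fun (f : hom_mod U J) : U -> J :=
  fun u => (f : {linear U -> J}) u.

Lemma hom_modP (f g : hom_mod U J) :
  hom_mod_fun f =1 hom_mod_fun g -> f = g.
Proof. exact: linear_eq. Qed.

Lemma scale_is_linear (a : k) (f : {linear U -> J}) :
  linear (fun u => a *: f u).
Proof.
by move=> b u v; rewrite linearP scalerDr !scalerA mulrC.
Qed.

Definition hom_zero : hom_mod U J := (\0 : U -> J).
Definition hom_opp (f : hom_mod U J) : hom_mod U J :=
  (\- (f : {linear U -> J})).
Definition hom_add (f g : hom_mod U J) : hom_mod U J :=
  ((f : {linear U -> J}) \+ (g : {linear U -> J})).
Definition hom_scale (a : k) (f : hom_mod U J) : hom_mod U J :=
  HB.pack (fun u => a *: (f : {linear U -> J}) u)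
    (GRing.isLinear.Build k U J *:%R _ (scale_is_linear a f)).

Lemma hom_addA : associative hom_add.
Proof. by move=> f g h; apply: hom_modP => u; exact: addrA. Qed.
Lemma hom_addC : commutative hom_add.
Proof. by move=> f g; apply: hom_modP => u; exact: addrC. Qed.
Lemma hom_add0 : left_id hom_zero hom_add.
Proof. by move=> f; apply: hom_modP => u; exact: add0r. Qed.
Lemma hom_addN : left_inverse hom_zero hom_opp hom_add.
Proof. by move=> f; apply: hom_modP => u; exact: addNr. Qed.

HB.instance Definition _ :=
  GRing.isZmodule.Build (hom_mod U J) hom_addA hom_addC hom_add0 hom_addN.

Lemma hom_scaleA a b f : hom_scale a (hom_scale b f) = hom_scale (a * b) f.
Proof. by apply: hom_modP => u; exact: scalerA. Qed.
Lemma hom_scale1 : left_id 1 hom_scale.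
Proof. by move=> f; apply: hom_modP => u; exact: scale1r. Qed.
Lemma hom_scaleDr : right_distributive hom_scale +%R.
Proof. by move=> a f g; apply: hom_modP => u; exact: scalerDr. Qed.
Lemma hom_scaleDl f : {morph hom_scale^~ f : a b / a + b}.
Proof. by move=> a b; apply: hom_modP => u; exact: scalerDl. Qed.

HB.instance Definition _ := GRing.Zmodule_isLmodule.Build k (hom_mod U J)
  hom_scaleA hom_scale1 hom_scaleDr hom_scaleDl.

End HomModule.

Section HomModuleMap.
Variables (k : comPzRingType) (J U V : lmodType k) (f : {linear U -> V}).

Definition hom_mod_map (phi : hom_mod V J) : hom_mod U J :=
  ((phi : {linear V -> J}) \o f).

Lemma hom_mod_map_is_linear : linear hom_mod_map.
Proof. by move=> a phi psi; apply: hom_modP. Qed.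

HB.instance Definition _ := GRing.isLinear.Build k (hom_mod V J) (hom_mod U J)
  *:%R hom_mod_map hom_mod_map_is_linear.

End HomModuleMap.

Section QuotientModule.
Local Open Scope quotient_scope.
Variables (k : comPzRingType) (V : lmodType k) (I : {pred V}).
Hypothesis (I_submod : submod_closed I).

Definition submod_pred of submod_closed I : {pred V} := I.

HB.instance Definition _ := GRing.isZmodClosed.Build V (submod_pred I_submod)
  (GRing.submod_closedB I_submod).

Definition quot_mod := Quotient.quot (submod_pred I_submod).
HB.instance Definition _ := GRing.Zmodule.on quot_mod.

Definition to_quot (v : V) : quot_mod := \pi_quot_mod v.
Definition of_quot (x : quot_mod) : V := repr x.

Lemma of_quotK : cancel of_quot to_quot.
Proof. exact: reprK. Qed.

Lemma to_quotP (u v : V) : (to_quot u = to_quot v) <-> (u - v \in I).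
Proof.
rewrite -[u - v \in I]/(u - v \in submod_pred I_submod) Quotient.idealrBE.
by split=> /eqP.
Qed.

Lemma to_quotD u v : to_quot (u + v) = to_quot u + to_quot v.
Proof. exact: raddfD. Qed.

Definition quot_scale (a : k) (x : quot_mod) : quot_mod :=
  to_quot (a *: of_quot x).

Lemma to_quotZ a v : to_quot (a *: v) = quot_scale a (to_quot v).
Proof.
apply/to_quotP; rewrite -scalerBr.
have [I0 Ilin] := I_submod; rewrite -[_ *: _]addr0; apply: Ilin => //.
by apply/to_quotP; rewrite of_quotK.
Qed.

Lemma quot_scaleA a b x : quot_scale a (quot_scale b x) = quot_scale (a * b) x.
Proof. by rewrite -[x]of_quotK -!to_quotZ scalerA. Qed.
Lemma quot_scale1 : left_id 1 quot_scale.
Proof. by move=> x; rewrite -[x]of_quotK -!to_quotZ scale1r. Qed.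
Lemma quot_scaleDr : right_distributive quot_scale +%R.
Proof.
by move=> a x y; rewrite -[x]of_quotK -[y]of_quotK -to_quotD -!to_quotZ
  -to_quotD scalerDr.
Qed.
Lemma quot_scaleDl x : {morph quot_scale^~ x : a b / a + b}.
Proof.
by move=> a b /=; rewrite -[x]of_quotK -!to_quotZ -to_quotD scalerDl.
Qed.

HB.instance Definition _ := GRing.Zmodule_isLmodule.Build k quot_mod
  quot_scaleA quot_scale1 quot_scaleDr quot_scaleDl.

Lemma to_quot_is_linear : linear to_quot.
Proof. by move=> a u v; rewrite to_quotD to_quotZ. Qed.

HB.instance Definition _ := GRing.isLinear.Build k V quot_mod *:%R to_quot
  to_quot_is_linear.

End QuotientModule.

Record lincat (k : comPzRingType) := Lincat {
  obj :> Type;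
  mor : obj -> obj -> lmodType k;
  idm : forall A, mor A A;
  mcomp : forall A B C, mor B C -> mor A B -> mor A C;
  mcompA : forall A B C D (h : mor C D) (g : mor B C) (f : mor A B),
    mcomp h (mcomp g f) = mcomp (mcomp h g) f;
  mcomp1m : forall A B (f : mor A B), mcomp (idm B) f = f;
  mcompm1 : forall A B (f : mor A B), mcomp f (idm A) = f;
  mcomp_linearl : forall A B C (f : mor A B),
    linear (fun g : mor B C => mcomp g f);
  mcomp_linearr : forall A B C (g : mor B C),
    linear (fun f : mor A B => mcomp g f)
}.

Arguments mor {k l}.
Arguments idm {k l}.
Arguments mcomp {k l A B C}.
Arguments mcomp_linearl {k l A B} C f.
Arguments mcomp_linearr {k l} A {B C} g.

Notation "g ∘ f" := (mcomp g f) (at level 40, left associativity).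

Record addcat (k : comPzRingType) := Addcat {
  addcat_lincat :> lincat k;
  zero_obj : addcat_lincat;
  zero_objP : idm zero_obj = 0;
  dsum : addcat_lincat -> addcat_lincat -> addcat_lincat;
  in1 : forall A B, mor A (dsum A B);
  in2 : forall A B, mor B (dsum A B);
  pr1 : forall A B, mor (dsum A B) A;
  pr2 : forall A B, mor (dsum A B) B;
  pr1_in1 : forall A B, pr1 A B ∘ in1 A B = idm A;
  pr2_in2 : forall A B, pr2 A B ∘ in2 A B = idm B;
  pr1_in2 : forall A B, pr1 A B ∘ in2 A B = 0;
  pr2_in1 : forall A B, pr2 A B ∘ in1 A B = 0;
  in_pr : forall A B,
    in1 A B ∘ pr1 A B + in2 A B ∘ pr2 A B = idm (dsum A B)
}.

Arguments zero_obj {k a}.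
Arguments dsum {k a}.
Arguments in1 {k a A B}.
Arguments in2 {k a A B}.
Arguments pr1 {k a A B}.
Arguments pr2 {k a A B}.

Notation "A ⊕ B" := (dsum A B) (at level 50, left associativity).

Section LinearCategory.
Variables (k : comPzRingType) (C : lincat k).
Implicit Types A B X Y Z L K : C.

Lemma mcomp0m A B Z (f : mor A B) : (0 : mor B Z) ∘ f = 0.
Proof.
have := mcomp_linearl Z f 1 0 0; rewrite /= !scale1r addr0 => /eqP.
by rewrite -subr_eq0 opprD addNKr oppr_eq0 => /eqP.
Qed.

Lemma mcompm0 A B Z (g : mor B Z) : g ∘ (0 : mor A B) = 0.
Proof.
have := mcomp_linearr A g 1 0 0; rewrite /= !scale1r addr0 => /eqP.
by rewrite -subr_eq0 opprD addNKr oppr_eq0 => /eqP.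
Qed.

Lemma mcompDl A B Z (g g' : mor B Z) (f : mor A B) :
  (g + g') ∘ f = g ∘ f + g' ∘ f.
Proof. by have := mcomp_linearl Z f 1 g g'; rewrite !scale1r. Qed.

Lemma mcompDr A B Z (g : mor B Z) (f f' : mor A B) :
  g ∘ (f + f') = g ∘ f + g ∘ f'.
Proof. by have := mcomp_linearr A g 1 f f'; rewrite !scale1r. Qed.

Lemma mcompNl A B Z (g : mor B Z) (f : mor A B) : (- g) ∘ f = - (g ∘ f).
Proof.
have := mcomp_linearl Z f (-1) g 0.
by rewrite /= mcomp0m !addr0 !scaleN1r.
Qed.

Lemma mcompNr A B Z (g : mor B Z) (f : mor A B) : g ∘ (- f) = - (g ∘ f).
Proof.
have := mcomp_linearr A g (-1) f 0.
by rewrite /= mcompm0 !addr0 !scaleN1r.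
Qed.

Definition is_iso A B (f : mor A B) : Prop :=
  exists g : mor B A, g ∘ f = idm A /\ f ∘ g = idm B.

Definition isomorphic A B : Prop := exists f : mor A B, is_iso f.

Definition is_zero A : Prop := idm A = 0.

Definition split_epi A B (f : mor A B) : Prop :=
  exists g : mor B A, f ∘ g = idm B.

Definition split_mono A B (f : mor A B) : Prop :=
  exists g : mor B A, g ∘ f = idm A.

(** [g] factors through [f], for morphisms with a common target, resp. with a
    common source. *)

Definition factors X Y L (g : mor L Y) (f : mor X Y) : Prop :=
  exists u : mor L X, g = f ∘ u.

Definition cofactors X Y L (g : mor X L) (f : mor X Y) : Prop :=
  exists u : mor Y L, g = u ∘ f.

Definition rad A B (f : mor A B) : Prop :=
  forall g : mor B A, is_iso (idm A - g ∘ f).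

Definition local_end A : Prop :=
  ~ is_zero A /\
  forall f g : mor A A, is_iso (f + g) -> is_iso f \/ is_iso g.

Definition right_almost_split A B (f : mor A B) : Prop :=
  ~ split_epi f /\ forall L (g : mor L B), ~ split_epi g -> factors g f.

Definition left_almost_split A B (f : mor A B) : Prop :=
  ~ split_mono f /\ forall L (g : mor A L), ~ split_mono g -> cofactors g f.

Definition right_determined X Y (f : mor X Y) (K : C) : Prop :=
  forall L (g : mor L Y), (forall h : mor K L, factors (g ∘ h) f) -> factors g f.

Definition left_determined X Y (f : mor X Y) (K : C) : Prop :=
  forall L (g : mor X L), (forall h : mor L K, cofactors (h ∘ g) f) ->
    cofactors g f.

Definition almost_factors X Y Z (g : mor Z Y) (f : mor X Y) : Prop :=
  ~ factors g f /\ forall T (h : mor T Z), rad h -> factors (g ∘ h) f.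

Definition left_minimal X Y (f : mor X Y) : Prop :=
  forall g : mor Y Y, g ∘ f = f -> is_iso g.

Definition left_minimal_version X Y Z (f : mor X Y) (f' : mor X Z) : Prop :=
  [/\ left_minimal f', cofactors f f' & cofactors f' f].

Definition right_End_submodule A X (H : mor A X -> Prop) : Prop :=
  [/\ H 0, forall f g, H f -> H g -> H (f - g)
    & forall f (e : mor A A), H f -> H (f ∘ e)].

Definition eqm A B (e : A = B) : mor A B :=
  match e in _ = B' return mor A B' with erefl => idm A end.

End LinearCategory.

Section AdditiveCategory.
Variables (k : comPzRingType) (C : addcat k).
Implicit Types A B : C.

Definition colm X A B (f : mor X A) (g : mor X B) : mor X (A ⊕ B) :=
  in1 ∘ f + in2 ∘ g.

Definition rowm A B X (f : mor A X) (g : mor B X) : mor (A ⊕ B) X :=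
  f ∘ pr1 + g ∘ pr2.

(** The matrix with rows [a b] and [c d]. *)
Definition matm A B A' B' (a : mor A A') (b : mor B A')
    (c : mor A B') (d : mor B B') : mor (A ⊕ B) (A' ⊕ B') :=
  colm (rowm a b) (rowm c d).

Lemma rowm_colm X A B Z (a : mor A Z) (b : mor B Z) (f : mor X A) (g : mor X B) :
  rowm a b ∘ colm f g = a ∘ f + b ∘ g.
Proof.
rewrite /rowm /colm !mcompDl !mcompDr.
rewrite -(mcompA a) (mcompA pr1) pr1_in1 mcomp1m.
rewrite -(mcompA a) (mcompA pr1) pr1_in2 mcomp0m mcompm0 addr0.
rewrite -(mcompA b) (mcompA pr2) pr2_in1 mcomp0m mcompm0 add0r.
by rewrite -(mcompA b) (mcompA pr2) pr2_in2 mcomp1m.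
Qed.

Lemma colm_comp X A B Z (f : mor X A) (g : mor X B) (h : mor Z X) :
  colm f g ∘ h = colm (f ∘ h) (g ∘ h).
Proof. by rewrite /colm mcompDl -!mcompA. Qed.

Lemma comp_rowm X A B Z (f : mor A X) (g : mor B X) (h : mor X Z) :
  h ∘ rowm f g = rowm (h ∘ f) (h ∘ g).
Proof. by rewrite /rowm mcompDr !mcompA. Qed.

Lemma rowmD A B X (f f' : mor A X) (g g' : mor B X) :
  rowm f g + rowm f' g' = rowm (f + f') (g + g').
Proof. by rewrite /rowm !mcompDl addrACA. Qed.

Lemma rowm0 A B X : rowm (0 : mor A X) (0 : mor B X) = 0.
Proof. by rewrite /rowm !mcomp0m addr0. Qed.

Lemma colm0 A B X : colm (0 : mor X A) (0 : mor X B) = 0.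
Proof. by rewrite /colm !mcompm0 addr0. Qed.

Definition indecomposable A : Prop :=
  ~ is_zero A /\ forall X Y, isomorphic A (X ⊕ Y) -> is_zero X \/ is_zero Y.

End AdditiveCategory.

Definition krull_schmidt (k : comPzRingType) (C : addcat k) : Prop :=
  forall A : C, exists (m : nat) (B : 'I_m -> C),
    (forall i, local_end (B i)) /\
    isomorphic A (\big[dsum/zero_obj]_(i < m) B i).

(** [ext E X A] is contravariant in [X] and covariant in [A]. *)
Record bifunctor (k : comPzRingType) (C : lincat k) := Bifunctor {
  ext :> C -> C -> lmodType k;
  push : forall X A A', mor A A' -> ext X A -> ext X A';
  pull : forall X X' A, mor X' X -> ext X A -> ext X' A;
  push_id : forall X A (x : ext X A), push (idm A) x = x;
  push_comp : forall X A B D (b : mor B D) (a : mor A B) (x : ext X A),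
    push (b ∘ a) x = push b (push a x);
  pull_id : forall X A (x : ext X A), pull (idm X) x = x;
  pull_comp : forall X Y Z A (b : mor Y X) (c : mor Z Y) (x : ext X A),
    pull (b ∘ c) x = pull c (pull b x);
  push_pull : forall X X' A A' (a : mor A A') (c : mor X' X) (x : ext X A),
    push a (pull c x) = pull c (push a x);
  push_linear : forall X A A' (a : mor A A'), linear (@push X A A' a);
  pull_linear : forall X X' A (c : mor X' X), linear (@pull X X' A c);
  push_linearl : forall X A A' (x : ext X A),
    linear (fun a : mor A A' => push a x);
  pull_linearl : forall X X' A (x : ext X A),
    linear (fun c : mor X' X => pull c x)
}.

Arguments push {k C} b {X A A'} : rename.
Arguments pull {k C} b {X X' A} : rename.

Definition ext_finite (k : comPzRingType) (C : lincat k) (E : bifunctor C) :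
  Prop := forall X A : C, fin_gen (E X A).

Section StableCategory.
Variables (k : comPzRingType) (C : lincat k) (E : bifunctor C).
Implicit Types A B X Y Z : C.

Definition proj_trivial X Y (f : mor X Y) : Prop :=
  forall Z (x : E Y Z), pull E f x = 0.

Definition inj_trivial X Y (f : mor X Y) : Prop :=
  forall Z (x : E Z X), push E f x = 0.

HB.instance Definition _ X A A' (a : mor A A') :=
  GRing.isLinear.Build k (E X A) (E X A') *:%R (@push k C E X A A' a)
    (push_linear a).

Definition injt A B : {pred mor A B} := fun f => `[< inj_trivial f >].
Arguments injt : clear implicits.

Lemma injtP A B (f : mor A B) : reflect (inj_trivial f) (f \in injt A B).
Proof. exact: asboolP. Qed.

Lemma injt_submod A B : submod_closed (injt A B).
Proof.
split=> [|a f g /injtP If /injtP Ig]; apply/injtP => Z x.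
  have := @push_linearl _ _ E Z A B x (-1) 0 0.
  by rewrite /= scaler0 addr0 scaleN1r addNr.
have := @push_linearl _ _ E Z A B x a f g.
by rewrite /= If Ig scaler0 addr0.
Qed.

Lemma injt_compl A B Z (g : mor B Z) (f : mor A B) :
  f \in injt A B -> g ∘ f \in injt A Z.
Proof.
by move=> /injtP If; apply/injtP => T x; rewrite push_comp If linear0.
Qed.

Lemma injt_compr A B Z (g : mor B Z) (f : mor A B) :
  g \in injt B Z -> g ∘ f \in injt A Z.
Proof.
by move=> /injtP Ig; apply/injtP => T x; rewrite push_comp Ig.
Qed.

Definition stable_hom A B : lmodType k := quot_mod (injt_submod A B).
Definition to_stable A B (f : mor A B) : stable_hom A B := to_quot _ f.
Definition of_stable A B (f : stable_hom A B) : mor A B := of_quot f.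

Definition stable_comp A B Z (g : stable_hom B Z) (f : stable_hom A B) :
    stable_hom A Z :=
  to_stable (of_stable g ∘ of_stable f).

Lemma to_stableP A B (f g : mor A B) :
  (to_stable f = to_stable g) <-> (f - g \in injt A B).
Proof. exact: to_quotP. Qed.

Lemma of_stableK A B (f : stable_hom A B) : to_stable (of_stable f) = f.
Proof. exact: of_quotK. Qed.

Lemma stable_compE A B Z (g : mor B Z) (f : mor A B) :
  stable_comp (to_stable g) (to_stable f) = to_stable (g ∘ f).
Proof.
apply/to_stableP.
set g' := of_stable _; set f' := of_stable _.
have Ig : g' - g \in injt B Z by apply/to_stableP; exact: of_stableK.
have If : f' - f \in injt A B by apply/to_stableP; exact: of_stableK.
have -> : g' ∘ f' - g ∘ f = 1 *: (g' ∘ (f' - f)) + (g' - g) ∘ f.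
  by rewrite scale1r mcompDr mcompDl mcompNl mcompNr addrA subrK.
by apply: (injt_submod _ _).2; [exact: injt_compl | exact: injt_compr].
Qed.

Lemma stable_compA A B Z T (h : stable_hom Z T) (g : stable_hom B Z)
    (f : stable_hom A B) :
  stable_comp h (stable_comp g f) = stable_comp (stable_comp h g) f.
Proof.
by rewrite -[f]of_stableK -[g]of_stableK -[h]of_stableK !stable_compE mcompA.
Qed.

Lemma stable_comp1m A B (f : stable_hom A B) :
  stable_comp (to_stable (idm B)) f = f.
Proof. by rewrite -[f]of_stableK stable_compE mcomp1m. Qed.

Lemma stable_compm1 A B (f : stable_hom A B) :
  stable_comp f (to_stable (idm A)) = f.
Proof. by rewrite -[f]of_stableK stable_compE mcompm1. Qed.

Lemma to_stable_linear A B : linear (@to_stable A B).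
Proof. exact: to_quot_is_linear. Qed.

Lemma stable_comp_linearl A B Z (f : stable_hom A B) :
  linear (fun g : stable_hom B Z => stable_comp g f).
Proof.
move=> a g g' /=.
rewrite -[f]of_stableK -[g]of_stableK -[g']of_stableK -to_stable_linear.
by rewrite !stable_compE mcomp_linearl to_stable_linear.
Qed.

Lemma stable_comp_linearr A B Z (g : stable_hom B Z) :
  linear (fun f : stable_hom A B => stable_comp g f).
Proof.
move=> a f f' /=.
rewrite -[g]of_stableK -[f]of_stableK -[f']of_stableK -to_stable_linear.
by rewrite !stable_compE mcomp_linearr to_stable_linear.
Qed.

Definition stable_cat : lincat k :=
  Lincat stable_compA stable_comp1m stable_compm1
    stable_comp_linearl stable_comp_linearr.

End StableCategory.

Record presheaf (k : comPzRingType) (C : lincat k) := Presheaf {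
  psh :> C -> lmodType k;
  psh_map : forall X Y : C, mor X Y -> {linear psh Y -> psh X};
  psh_id : forall X, psh_map (idm X) =1 id;
  psh_comp : forall X Y Z (g : mor Y Z) (f : mor X Y),
    psh_map (g ∘ f) =1 psh_map f \o psh_map g
}.

Arguments psh_map {k C} p {X Y} : rename.

Definition presheaf_iso (k : comPzRingType) (C : lincat k) (F G : presheaf C) :
    Prop :=
  exists eta : forall Y : C, {linear F Y -> G Y},
    (forall Y, bijective (eta Y)) /\
    forall (X Y : C) (f : mor X Y) (x : F Y),
      eta X (psh_map F f x) = psh_map G f (eta Y x).

Section Yoneda.
Variables (k : comPzRingType) (C : lincat k) (A : C).

Definition precomp (X Y : C) (f : mor X Y) (g : mor Y A) : mor X A := g ∘ f.

HB.instance Definition _ X Y (f : mor X Y) :=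
  GRing.isLinear.Build k (mor Y A) (mor X A) *:%R (precomp f)
    (mcomp_linearl A f).

Lemma yoneda_id X : precomp (idm X) =1 id.
Proof. by move=> g; exact: mcompm1. Qed.

Lemma yoneda_comp X Y Z (g : mor Y Z) (f : mor X Y) :
  precomp (g ∘ f) =1 precomp f \o precomp g.
Proof. by move=> h; exact: mcompA. Qed.

Definition yoneda : presheaf C :=
  @Presheaf k C (fun X => mor X A) (fun X Y f => precomp f)
    yoneda_id yoneda_comp.

End Yoneda.

Definition representable (k : comPzRingType) (C : lincat k) (F : presheaf C) :
    Prop :=
  exists A : C, presheaf_iso F (yoneda A).

Section DualExt.
Variables (k : comPzRingType) (J : lmodType k) (C : lincat k).
Variables (E : bifunctor C) (X : C).

Definition dual_ext_map (Y Z : stable_cat E) (f : mor Y Z) :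
    {linear hom_mod (E X Z) J -> hom_mod (E X Y) J} :=
  hom_mod_map (@push k C E X Y Z (of_stable f)).

Lemma push_of_stable Y Z (f : mor Y Z) (x : E X Y) :
  push E (of_stable (to_stable E f)) x = push E f x.
Proof.
set f' := of_stable _.
have /injtP/(_ X x) : f' - f \in @injt k C E Y Z.
  by apply/to_stableP; exact: of_stableK.
have := @push_linearl _ _ E X Y Z x (-1) f f'.
rewrite /= !scaleN1r [- f + _]addrC => -> /eqP.
by rewrite addrC subr_eq0 => /eqP.
Qed.

Lemma dual_ext_id (Y : stable_cat E) : dual_ext_map (idm Y) =1 id.
Proof.
move=> phi; apply: hom_modP => x; rewrite /hom_mod_fun /=.
by rewrite push_of_stable push_id.
Qed.

Lemma dual_ext_comp (Y Z T : stable_cat E) (g : mor Z T) (f : mor Y Z) :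
  dual_ext_map (g ∘ f) =1 dual_ext_map f \o dual_ext_map g.
Proof.
move=> phi; apply: hom_modP => x; rewrite /hom_mod_fun /=.
by rewrite push_of_stable push_comp.
Qed.

Definition dual_ext : presheaf (stable_cat E) :=
  @Presheaf k (stable_cat E) (fun Y => hom_mod (E X Y) J) dual_ext_map
    dual_ext_id dual_ext_comp.

End DualExt.

(** A complex [X_0 -> ... -> X_{n+1}] from [A] to [B].  Objects and
    differentials are indexed by all natural numbers; only [X_0, ..., X_{n+1}]
    and [d_0, ..., d_n] carry meaning, and the definitions below never look at
    the others. *)
Record cplx (k : comPzRingType) (C : lincat k) (n : nat) (A B : C) := Cplx {
  cob :> nat -> C;
  cdiff : forall i, mor (cob i) (cob i.+1);
  cob_first : cob 0%N = A;
  cob_last : cob n.+1 = B;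
  cdiff_cdiff : forall i, (i < n)%N -> cdiff i.+1 ∘ cdiff i = 0
}.

Arguments cdiff {k C n A B}.

Section Complexes.
Variables (k : comPzRingType) (C : lincat k) (n : nat).

(** [d_0] and [d_n] with source, resp. target, the prescribed end term. *)
Definition first_diff (A B : C) (X : cplx n A B) : mor A (X 1%N) :=
  cdiff X 0 ∘ eqm (esym (cob_first X)).

Definition last_diff (A B : C) (X : cplx n A B) : mor (X n) B :=
  eqm (cob_last X) ∘ cdiff X n.

Record chain_map (A B A' B' : C) (X : cplx n A B) (Y : cplx n A' B') :=
  ChainMap {
    cmap :> forall i, mor (X i) (Y i);
    cmapP : forall i, (i <= n)%N -> cmap i.+1 ∘ cdiff X i = cdiff Y i ∘ cmap i
  }.

Definition has_ends (A B A' B' : C) (X : cplx n A B) (Y : cplx n A' B')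
    (a : mor A A') (b : mor B B') (f : chain_map X Y) : Prop :=
  f 0%N ∘ eqm (esym (cob_first X)) = eqm (esym (cob_first Y)) ∘ a /\
  eqm (cob_last Y) ∘ f n.+1 = b ∘ eqm (cob_last X).

(** Homotopy of chain maps that agree on the end terms; [h i] is the component
    [X_{i+1} -> Y_i]. *)
Definition homotopic (A B A' B' : C) (X : cplx n A B) (Y : cplx n A' B')
    (f g : forall i, mor (X i) (Y i)) : Prop :=
  exists h : forall i, mor (X i.+1) (Y i),
    [/\ h 0%N ∘ cdiff X 0 = 0,
        forall i, (i < n)%N ->
          g i.+1 - f i.+1 = cdiff Y i ∘ h i + h i.+1 ∘ cdiff X i.+1
      & cdiff Y n ∘ h n = 0].

Definition homotopy_equivalent (A B : C) (X Y : cplx n A B) : Prop :=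
  exists (f : chain_map X Y) (g : chain_map Y X),
    [/\ has_ends (idm A) (idm B) f, has_ends (idm A) (idm B) g,
        homotopic (fun i => g i ∘ f i) (fun i => idm (X i))
      & homotopic (fun i => f i ∘ g i) (fun i => idm (Y i))].

Definition exangle (E : bifunctor C) (A B : C) (X : cplx n A B) (x : E B A) :
    Prop :=
  (forall T : C,
     (forall i (g : mor T (X i.+1)), (i < n)%N ->
        (cdiff X i.+1 ∘ g = 0 <-> exists h, g = cdiff X i ∘ h)) /\
     (forall g : mor T B,
        pull E g x = 0 <-> exists h, g = last_diff X ∘ h)) /\
  (forall T : C,
     (forall i (g : mor (X i.+1) T), (i < n)%N ->
        (g ∘ cdiff X i = 0 <-> exists h, g = h ∘ cdiff X i.+1)) /\
     (forall g : mor A T,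
        push E g x = 0 <-> exists h, g = h ∘ first_diff X)).

End Complexes.

(** The complexes [A = A -> 0 -> ... -> 0] and [0 -> ... -> 0 -> A = A]. *)

Section TrivialComplexes.
Variables (k : comPzRingType) (C : addcat k) (n : nat).
Hypothesis (n_gt0 : (0 < n)%N).
Variable (A : C).

Definition trivl_ob (j : nat) : C := if j is j'.+2 then zero_obj else A.

Definition trivl_diff (j : nat) : mor (trivl_ob j) (trivl_ob j.+1) :=
  if j is j'.+1 return mor (trivl_ob j) (trivl_ob j.+1) then 0 else idm A.

Lemma trivl_last : trivl_ob n.+1 = zero_obj.
Proof. by case: n n_gt0. Qed.

Lemma trivl_diff_diff i : (i < n)%N -> trivl_diff i.+1 ∘ trivl_diff i = 0.
Proof. by move=> _; exact: mcomp0m. Qed.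

Definition trivl : cplx n A zero_obj :=
  @Cplx k C n A zero_obj trivl_ob trivl_diff erefl trivl_last trivl_diff_diff.

Definition trivr_ob (j : nat) : C := if (j < n)%N then zero_obj else A.

Definition trivr_diff (j : nat) : mor (trivr_ob j) (trivr_ob j.+1) :=
  match (j < n)%N as b, (j.+1 < n)%N as b'
    return mor (if b then zero_obj else A) (if b' then zero_obj else A) with
  | false, false => idm A
  | _, _ => 0
  end.

Lemma trivr_first : trivr_ob 0 = zero_obj.
Proof. by rewrite /trivr_ob n_gt0. Qed.

Lemma trivr_last : trivr_ob n.+1 = A.
Proof. by rewrite /trivr_ob ltnNge leqnSn. Qed.

Lemma trivr_diff_diff i : (i < n)%N -> trivr_diff i.+1 ∘ trivr_diff i = 0.
Proof.
move=> lt_in; suff -> : trivr_diff i = 0 by exact: mcompm0.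
by rewrite /trivr_diff /trivr_ob lt_in.
Qed.

Definition trivr : cplx n zero_obj A :=
  @Cplx k C n zero_obj A trivr_ob trivr_diff trivr_first trivr_last
    trivr_diff_diff.

End TrivialComplexes.

(** In [cone_diff] and [cocone_diff] the branches for [n = 0], and those beyond
    the last term of the complex, are fillers. *)

Section Cone.
Variables (k : comPzRingType) (C : addcat k) (n : nat).
Variables (A B A' B' : C) (X : cplx n A B) (Y : cplx n A' B').
Variable (f : chain_map X Y).

Definition cone_ob (j : nat) : C :=
  if j is i.+1 then
    if i == n then Y i.+1 else X i.+2 ⊕ Y i.+1
  else X 1%N.

Definition cone_diff (j : nat) : mor (cone_ob j) (cone_ob j.+1) :=
  match j return mor (cone_ob j) (cone_ob j.+1) with
  | 0 =>
    match 0%N == n as b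
      return mor (X 1%N) (if b then Y 1%N else X 2%N ⊕ Y 1%N) with
    | true => 0
    | false => colm (- cdiff X 1) (f 1%N)
    end
  | i.+1 =>
    match i == n as b, i.+1 == n as b'
      return mor (if b then Y i.+1 else X i.+2 ⊕ Y i.+1)
                 (if b' then Y i.+2 else X i.+3 ⊕ Y i.+2) with
    | true, _ => 0
    | false, true => rowm (f i.+2) (cdiff Y i.+1)
    | false, false => matm (- cdiff X i.+2) 0 (f i.+2) (cdiff Y i.+1)
    end
  end.

Lemma cone_last : cone_ob n.+1 = B'.
Proof. by rewrite /= eqxx cob_last. Qed.

Lemma cone_diff_diff i : (i < n)%N -> cone_diff i.+1 ∘ cone_diff i = 0.
Proof.
case: i => [|i] lt_in.
  rewrite /cone_diff /cone_ob; case: (0%N =P n) => [e0|_].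
    by exfalso; move: lt_in; rewrite -e0.
  case: (1%N =P n) => [_|/eqP n1].
    by rewrite rowm_colm mcompNr cmapP // addNr.
  have lt1n : (1 < n)%N by rewrite ltn_neqAle n1.
  rewrite /matm colm_comp !rowm_colm mcomp0m addr0 !(mcompNl, mcompNr) opprK.
  by rewrite cdiff_cdiff // cmapP // addNr colm0.
rewrite /cone_diff /cone_ob.
case: (i =P n) => [e|_].
  by exfalso; move: lt_in; rewrite e ltnNge leqnSn.
case: (i.+1 =P n) => [e|_]; first by exfalso; move: lt_in; rewrite e ltnn.
case: (i.+2 =P n) => [_|/eqP ni].
  rewrite /matm rowm_colm !comp_rowm rowmD mcompm0 add0r mcompNr cmapP //.
  by rewrite addNr cdiff_cdiff ?rowm0 // ltnW.
have lti : (i.+2 < n)%N by rewrite ltn_neqAle ni.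
rewrite /matm colm_comp !rowm_colm !comp_rowm !rowmD.
rewrite !mcomp0m !mcompm0 ?(mcompNl, mcompNr) !addr0 ?opprK ?add0r.
by rewrite !cdiff_cdiff // ?cmapP // ?addNr ?rowm0 ?colm0 // ltnW.
Qed.

Definition cone : cplx n (X 1%N) B' :=
  @Cplx k C n (X 1%N) B' cone_ob cone_diff erefl cone_last cone_diff_diff.

End Cone.

(** [X_0 -> Y_0 ⊕ X_1 -> ... -> Y_{n-1} ⊕ X_n -> Y_n]: the cone of [f] in the
    opposite category.  The signs matter, since the extension realized by this
    complex depends on them. *)

Section Cocone.
Variables (k : comPzRingType) (C : addcat k) (n : nat).
Variables (A B A' B' : C) (X : cplx n A B) (Y : cplx n A' B').
Variable (f : chain_map X Y).

Definition cocone_ob (j : nat) : C :=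
  if j is i.+1 then
    if i == n then Y i else Y i ⊕ X i.+1
  else X 0%N.

Definition cocone_diff (j : nat) : mor (cocone_ob j) (cocone_ob j.+1) :=
  match j return mor (cocone_ob j) (cocone_ob j.+1) with
  | 0 =>
    match 0%N == n as b
      return mor (X 0%N) (if b then Y 0%N else Y 0%N ⊕ X 1%N) with
    | true => 0
    | false => colm (f 0%N) (cdiff X 0)
    end
  | i.+1 =>
    match i == n as b, i.+1 == n as b'
      return mor (if b then Y i else Y i ⊕ X i.+1)
                 (if b' then Y i.+1 else Y i.+1 ⊕ X i.+2) with
    | true, _ => 0
    | false, true => rowm (- cdiff Y i) (f i.+1)
    | false, false => matm (- cdiff Y i) (f i.+1) 0 (cdiff X i.+1)
    end
  end.

Lemma cocone_last : cocone_ob n.+1 = Y n.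
Proof. by rewrite /= eqxx. Qed.

Lemma cocone_diff_diff i : (i < n)%N -> cocone_diff i.+1 ∘ cocone_diff i = 0.
Proof.
case: i => [|i] lt_in.
  rewrite /cocone_diff /cocone_ob; case: (0%N =P n) => [e0|_].
    by exfalso; move: lt_in; rewrite -e0.
  case: (1%N =P n) => [_|/eqP n1].
    by rewrite rowm_colm mcompNl cmapP // addNr.
  rewrite /matm colm_comp !rowm_colm mcomp0m add0r mcompNl cmapP // addNr.
  by rewrite cdiff_cdiff ?colm0.
rewrite /cocone_diff /cocone_ob.
case: (i =P n) => [e|_].
  by exfalso; move: lt_in; rewrite e ltnNge leqnSn.
case: (i.+1 =P n) => [e|_]; first by exfalso; move: lt_in; rewrite e ltnn.
have lei := ltnW lt_in.
case: (i.+2 =P n) => [_|/eqP ni].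
  rewrite /matm rowm_colm !comp_rowm rowmD mcompm0 addr0 !mcompNl mcompNr opprK.
  by rewrite cdiff_cdiff // cmapP // addNr rowm0.
rewrite /matm colm_comp !rowm_colm !comp_rowm !rowmD.
rewrite !mcomp0m !mcompm0 ?(mcompNl, mcompNr) !addr0 ?opprK ?add0r.
by rewrite !cdiff_cdiff // ?cmapP // ?addNr ?rowm0 ?colm0.
Qed.

Definition cocone : cplx n A (Y n) :=
  @Cplx k C n A (Y n) cocone_ob cocone_diff (cob_first X) cocone_last
    cocone_diff_diff.

End Cocone.

(** [s x X] reads [s(x) = [X]]: a realization is given by the class of
    complexes that it assigns to each extension; [realization_class] below
    makes each [s x] a homotopy class. *)
Definition realization (k : comPzRingType) (C : lincat k) (n : nat)
    (E : bifunctor C) : Type :=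
  forall A B : C, E B A -> cplx n A B -> Prop.

Section Exangulated.
Variables (k : comPzRingType) (C : addcat k) (n : nat) (E : bifunctor C).
Variable (s : realization n E).

Record exact_realization (n_gt0 : (0 < n)%N) : Prop := ExactRealization {
  realization_class : forall (A B : C) (x : E B A),
    exists X, forall Y, s x Y <-> homotopy_equivalent X Y;
  realization_lift : forall (A B A' B' : C) (x : E B A) (y : E B' A')
      (X : cplx n A B) (Y : cplx n A' B') (a : mor A A') (b : mor B B'),
    s x X -> s y Y -> push E a x = pull E b y ->
    exists f : chain_map X Y, has_ends a b f;
  realization_exangle : forall (A B : C) (x : E B A) (X : cplx n A B),
    s x X -> exangle X x;
  realization_trivl : forall A : C, s (0 : E zero_obj A) (trivl n_gt0 A);
  realization_trivr : forall A : C, s (0 : E A zero_obj) (trivr n_gt0 A)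
}.

Definition distinguished (A B : C) (x : E B A) (X : cplx n A B) : Prop := s x X.

(** [is_first_diff X f] says that [f] is the morphism [d_0] of [X], its target
    included; likewise for [is_last_diff]. *)
Inductive is_first_diff (A B : C) (X : cplx n A B) :
    forall Z : C, mor A Z -> Prop :=
  IsFirstDiff : is_first_diff X (first_diff X).

Inductive is_last_diff (A B : C) (X : cplx n A B) :
    forall Z : C, mor Z B -> Prop :=
  IsLastDiff : is_last_diff X (last_diff X).

Definition inflation (A Z : C) (f : mor A Z) : Prop :=
  exists (B : C) (x : E B A) (X : cplx n A B),
    distinguished x X /\ is_first_diff X f.

Definition deflation (Z B : C) (f : mor Z B) : Prop :=
  exists (A : C) (x : E B A) (X : cplx n A B),
    distinguished x X /\ is_last_diff X f.

Record exangulated (n_gt0 : (0 < n)%N) : Prop := Exangulated {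
  exangulated_realization : exact_realization n_gt0;
  inflation_comp : forall (X Y Z : C) (g : mor Y Z) (f : mor X Y),
    inflation g -> inflation f -> inflation (g ∘ f);
  deflation_comp : forall (X Y Z : C) (g : mor Y Z) (f : mor X Y),
    deflation g -> deflation f -> deflation (g ∘ f);
  exangulated_cone : forall (A B D : C) (y : E D A) (c : mor B D)
      (X : cplx n A B) (Y : cplx n A D),
    distinguished (pull E c y) X -> distinguished y Y ->
    exists f : chain_map X Y,
      has_ends (idm A) c f /\
      distinguished (push E (first_diff X) y) (cone f);
  exangulated_cocone : forall (A A' B : C) (x : E B A) (a : mor A A')
      (X : cplx n A B) (Y : cplx n A' B),
    distinguished x X -> distinguished (push E a x) Y ->
    exists f : chain_map X Y,
      has_ends a (idm B) f /\
      distinguished (pull E (last_diff Y) x) (cocone f)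
}.

Definition WIC : Prop :=
  forall (X Y Z : C) (f : mor X Y) (g : mor Y Z),
    (deflation (g ∘ f) -> deflation g) /\ (inflation (g ∘ f) -> inflation f).

Definition projective (P : C) : Prop :=
  forall (A B : C) (x : E B A) (X : cplx n A B),
    distinguished x X ->
  forall p : mor P B, factors p (last_diff X).

Definition AR_exangle (A B : C) (x : E B A) (X : cplx n A B) : Prop :=
  [/\ distinguished x X, left_almost_split (first_diff X),
      right_almost_split (last_diff X)
    & forall i, (0 < i < n)%N -> rad (cdiff X i)].

Definition intrinsic_weak_cokernel (A Y : C) (f : mor A Y) (Z : C) : Prop :=
  inflation f /\
  exists (Z1 : C) (f' : mor A Z1), left_minimal_version f f' /\
  exists (x : E Z A) (X : cplx n A Z), distinguished x X /\ is_first_diff X f'.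

End Exangulated.

(** The object [X] belongs to [C_r]; [J] is the minimal injective cogenerator. *)
Definition in_Cr (k : comPzRingType) (J : lmodType k) (C : lincat k)
    (E : bifunctor C) (X : C) : Prop :=
  representable (dual_ext J E X).

(* Main.v *)
Require Import Defs.
From HB Require Import structures.
From mathcomp Require Import all_boot all_algebra.
From mathcomp Require Import boolp.

Set Implicit Arguments.
Unset Strict Implicit.
Unset Printing Implicit Defensive.

Import GRing.Theory.
Import Defs.
Local Open Scope ring_scope.

(** The proof turns every condition into one about a single extension.

    The engine is a pair of exact sequences.  If a distinguished exangle [X]
    realizes [x] in [E(B, A)], then an extension of [F] by [A] that dies under
    [d_0] is a pullback of [x] ([push_first_diff_exact]), and an extension of
    [B] by [F] that dies under [d_n] is a pushforward of [x]
    ([pull_last_diff_exact]).  Both come from a cone, resp. a cocone, which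
    realizes the zero extension and therefore splits.

    Call [x] almost vanishing if it is nonzero and radical morphisms kill it.
    When [B] is local, almost vanishing under pullback implies almost vanishing
    under pushforward, and conversely when [A] is local.  So an almost vanishing
    extension on either side yields, after projecting [A] to a local summand, an
    Auslander-Reiten exangle: the two almost split ends are a restatement of
    almost vanishing, and the middle differentials become radical when
    isomorphic local summands of neighbouring terms are cancelled, which only
    changes the complex up to homotopy ([radical_representative]).  A morphism
    that almost factors through a deflation exhibits an almost vanishing
    pullback, and determined morphisms lead to almost vanishing extensions too:
    a determined deflation or inflation that does not split gives a nonzero
    submodule of some [E(C, A)], and a minimal cyclic submodule over the
    endomorphism ring has an almost vanishing generator ([right_socle],
    [left_socle]).

    Membership in [C_r] means, by Yoneda, that there are an object [T] and a
    linear form [gamma] on [E(C, T)] for which [f |-> gamma (f_* -)] identifies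
    the stable morphisms [Y -> T] with [D E(C, Y)] ([in_Cr_dualizes]).  For an
    Auslander-Reiten exangle starting at [T], any form that does not vanish on
    its extension gives a pairing of [E(C, Y)] with the morphisms [Y -> T] that
    is nondegenerate on both sides.  That such a pairing is perfect is Matlis
    duality: submodules of [Hom(M, J)] are their own double annihilators when
    [J] is the minimal injective cogenerator ([submodule_double_perp]).

    Conversely, [gamma] also pairs the morphisms [C -> Y] with [E(Y, T)], and
    the orthogonal of [E(Y, T)] consists of the projectively trivial morphisms.
    A submodule [H] containing these is its own double orthogonal, and
    generators [y_1, ..., y_m] of its orthogonal form one extension of [Y] by
    [T^m] whose realization ends in a determined deflation with image [H]
    ([determined_deflation_exists]). *)

(** * Chain conditions and length of modules *)

Section Submodules.
Variables (k : comPzRingType) (U : lmodType k).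
Implicit Types (N K P Q : U -> Prop) (s : seq U).

Definition submodule N : Prop :=
  N 0 /\ forall a x y, N x -> N y -> N (a *: x + y).

Lemma submoduleD N x y : submodule N -> N x -> N y -> N (x + y).
Proof. by move=> [_ Nl] Nx Ny; rewrite -[x]scale1r; exact: Nl. Qed.

Lemma submoduleZ N a x : submodule N -> N x -> N (a *: x).
Proof. by move=> [N0 Nl] Nx; rewrite -[_ *: _]addr0; exact: Nl. Qed.

Lemma submoduleB N x y : submodule N -> N x -> N y -> N (x - y).
Proof.
move=> sN Nx Ny; rewrite -scaleN1r; apply: submoduleD => //.
exact: submoduleZ.
Qed.

(** The subquotient [Q / P] is simple or zero. *)
Definition small P Q : Prop :=
  forall x y, Q x -> Q y -> ~ P x -> exists a : k, P (y - a *: x).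

(** The length of [U / K] is at most [l].  Zero steps count as steps, so that
    [K] may be enlarged without a new filtration. *)
Fixpoint colength_le (l : nat) K : Prop :=
  if l is l'.+1 then
    exists K1, [/\ submodule K1, forall x, K x -> K1 x, small K K1
      & colength_le l' K1]
  else forall x, K x.

Lemma colength_le_mono l K K' :
  submodule K' -> (forall x, K x -> K' x) -> colength_le l K ->
  colength_le l K'.
Proof.
elim: l K K' => [|l IHl] K K' sK' KK' /=; first by move=> Kfull x; exact: KK'.
move=> [K1 [sK1 KK1 KK1s cK1]].
pose K1' x := exists y z, [/\ K1 y, K' z & x = y + z].
have sK1' : submodule K1'.
  split.
    by exists 0, 0; rewrite addr0; split=> //; [case: sK1 | case: sK'].
  move=> a x y [x1 [x2 [K1x1 K'x2 ->]]] [y1 [y2 [K1y1 K'y2 ->]]].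
  exists (a *: x1 + y1), (a *: x2 + y2); split.
  - by case: sK1 => _; apply.
  - by case: sK' => _; apply.
  - by rewrite scalerDr addrACA.
exists K1'; split=> //.
- by move=> x K'x; exists 0, x; rewrite add0r; split=> //; case: sK1.
- move=> x y [x1 [x2 [K1x1 K'x2 ->]]] [y1 [y2 [K1y1 K'y2 ->]]] nK'x.
  have /(KK1s x1 y1 K1x1 K1y1) [a Ka] : ~ K x1.
    by move=> /KK' K'x1; apply: nK'x; exact: submoduleD.
  exists a; rewrite scalerDr opprD addrACA; apply: submoduleD => //.
    exact: KK'.
  by apply: submoduleB => //; exact: submoduleZ.
- apply: (IHl K1) => // x K1x; exists x, 0; rewrite addr0; split=> //.
  by case: sK'.
Qed.

Fixpoint span s (x : U) : Prop :=
  if s is g :: s' then exists a y, span s' y /\ x = a *: g + y else x = 0.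

Lemma span_submodule s : submodule (span s).
Proof.
elim: s => [|g s [s0 sl]] /=.
  by split=> // a x y -> ->; rewrite scaler0 addr0.
split; first by exists 0, 0; rewrite scale0r addr0.
move=> a _ _ [b [x [sx ->]]] [c [y [sy ->]]].
exists (a * b + c), (a *: x + y); split; first exact: sl.
by rewrite scalerDr scalerA scalerDl addrACA.
Qed.

Lemma span_behead g s x : span s x -> span (g :: s) x.
Proof. by move=> sx; exists 0, x; rewrite scale0r add0r. Qed.

Lemma span_head g s : span (g :: s) g.
Proof.
by exists 1, 0; rewrite scale1r addr0; split=> //; case: (span_submodule s).
Qed.

Lemma span_sub N s : submodule N -> (forall x, x \in s -> N x) ->
  forall x, span s x -> N x.
Proof.
move=> sN; elim: s => [|g s IHs] Ns x /=; first by move->; case: sN.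
move=> [a [y [sy ->]]]; case: (sN) => _; apply.
  by apply: Ns; rewrite mem_head.
by apply: IHs sy => z zs; apply: Ns; rewrite inE zs orbT.
Qed.

Lemma fin_gen_span : fin_gen U <-> exists s, forall x, span s x.
Proof.
split=> [[m [g gU]]|[s sU]].
  exists [seq g i | i <- index_enum 'I_m] => x; have [c ->] := gU x.
  elim: (index_enum _) => [|i r IHr]; first by rewrite big_nil.
  by rewrite big_cons /=; exists (c i), (\sum_(j <- r) c j *: g j).
exists (size s), (fun i => s`_i) => x.
have {sU} := sU x; elim: s x => [|g s IHs] x /=.
  by move=> ->; exists (fun=> 0); rewrite big_ord0.
move=> [a [y [/IHs [c ->] ->]]].
exists (fun i => oapp c a (unlift ord0 i)); rewrite big_ord_recl unlift_none /=.
by congr (_ + _); apply: eq_bigr => i _; rewrite liftK.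
Qed.

(** The ascending and the descending case share their proofs, hence the
    Boolean: [b = true] stands for descending chains. *)
Definition chain (b : bool) (N : nat -> U -> Prop) : Prop :=
  forall m x, if b then N m.+1 x -> N m x else N m x -> N m.+1 x.

Definition stationary (N : nat -> U -> Prop) : Prop :=
  exists m, forall p, (m <= p)%N -> forall x, N p x <-> N m x.

Definition chain_cond (b : bool) : Prop :=
  forall N : nat -> U -> Prop,
    (forall m, submodule (N m)) -> chain b N -> stationary N.

Lemma chain_le b (N : nat -> U -> Prop) m p : chain b N -> (m <= p)%N ->
  forall x, if b then N p x -> N m x else N m x -> N p x.
Proof.
move=> cN /subnK <-; elim: (p - m)%N => [|d IHd] x; first by case: b {cN}.
have := IHd x; have := cN (d + m)%N x; rewrite addSn.
by case: b {cN IHd}; [move=> h1 h2 /h1 | move=> h1 h2 /h2].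
Qed.

(** Without an extremal member, dependent choice would build a strictly
    monotone chain. *)
Lemma chain_cond_extremal b (F : (U -> Prop) -> Prop) :
  chain_cond b -> (forall N, F N -> submodule N) -> (exists N, F N) ->
  exists N, F N /\ forall N', F N' ->
    (forall x, if b then N' x -> N x else N x -> N' x) ->
    forall x, N' x <-> N x.
Proof.
move=> ccU Fsub [N0 FN0]; apply: contrapT => nex.
have step (N : {N | F N}) : exists N' : {N | F N},
    (forall x, if b then sval N' x -> sval N x else sval N x -> sval N' x) /\
    ~ (forall x, sval N' x <-> sval N x).
  apply: contrapT => nstep; apply: nex; exists (sval N); split.
    exact: (svalP N).
  move=> N' FN' NN'; apply: contrapT => nNN'.
  by apply: nstep; exists (exist _ N' FN').
have [next nextP] := choice step.
pose N m := iter m next (exist _ N0 FN0).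
have [m mP] : stationary (fun m => sval (N m)).
  apply: ccU => [m|m x]; first exact: Fsub (svalP (N m)).
  by have [h _] := nextP (N m); exact: h.
have [_] := nextP (N m); apply; exact: (mP m.+1).
Qed.

(** A finitely spanned submodule of [N] of largest extent absorbs every element
    of [N]. *)
Lemma fin_gen_submodule N : chain_cond false -> submodule N ->
  exists s, (forall x, x \in s -> N x) /\ forall x, N x -> span s x.
Proof.
move=> acc sN.
pose F P := exists s, (forall x, x \in s -> N x) /\ P = span s.
have [||P [[s [sN' ->]] Pmax]] := chain_cond_extremal acc (F := F).
- by move=> _ [s [_ ->]]; exact: span_submodule.
- by exists (span [::]), [::].
exists s; split=> // x Nx.
have Fxs : F (span (x :: s)).
  exists (x :: s); split=> // y; rewrite inE => /orP [/eqP -> //|]; exact: sN'.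
by apply/(Pmax _ Fxs (@span_behead x s) x); exact: span_head.
Qed.

(** With both chain conditions every quotient has finite length: a maximal
    counterexample [K] is proper, and a submodule minimal among those strictly
    above [K] is one simple step away from it. *)
Lemma finite_colength K : chain_cond true -> chain_cond false ->
  submodule K -> exists l, colength_le l K.
Proof.
move=> dcc acc sK; apply: contrapT => ncK.
pose F P := submodule P /\ ~ exists l, colength_le l P.
have [||{sK ncK}{}K [[sK ncK] Kmax]] := chain_cond_extremal acc (F := F).
- by move=> P [].
- by exists K.
have {Kmax} cK K' : submodule K' -> (forall x, K x -> K' x) ->
    ~ (forall x, K' x -> K x) -> exists l, colength_le l K'.
  move=> sK' KK' nK'K; apply: contrapT => ncK'.
  by apply: nK'K => x; apply: (Kmax K' _ KK' x).1.
pose G P := [/\ submodule P, forall x, K x -> P x & ~ (forall x, P x -> K x)].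
have [||K1 [[sK1 KK1 nK1K] K1min]] := chain_cond_extremal dcc (F := G).
- by move=> P [].
- exists (fun=> True); split=> // Kfull; apply: ncK; exists 0%N => x.
  exact: Kfull.
have [l cK1] := cK _ sK1 KK1 nK1K.
apply: ncK; exists l.+1, K1; split=> // x y K1x K1y nKx.
pose Kx z := exists a, K (z - a *: x).
have KxE : forall z, Kx z <-> K1 z.
  apply: K1min => [|z [a Ka]]; last first.
    rewrite -(subrK (a *: x) z); apply: submoduleD => //; first exact: KK1.
    exact: submoduleZ.
  split=> [|z Kz|KxK].
  - split; first by exists 0; rewrite scale0r subr0; case: sK.
    move=> a y1 y2 [b Kb] [c Kc]; exists (a * b + c).
    rewrite scalerDl opprD addrACA -scalerA -scalerBr.
    by case: sK => _; apply.
  - by exists 0; rewrite scale0r subr0.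
  - apply: nKx; apply: KxK; exists 1; rewrite scale1r subrr; by case: sK.
by have [] := (KxE y).2 K1y => a Ka; exists a.
Qed.

End Submodules.

Arguments submodule {k U}.
Arguments span {k U}.
Arguments chain_cond {k}.
Arguments chain_cond_extremal {k U b F}.

Section FinitelyGenerated.
Variables (k : comPzRingType).

(** The induction on generators: a submodule of [k g + span s] is controlled by
    its intersection with [span s] and by its ideal of coefficients of [g]. *)
Lemma sub_span_cons (U : lmodType k) (g : U) s (P Q : U -> Prop) :
  submodule P -> submodule Q -> (forall x, P x -> Q x) ->
  (forall x, Q x -> span (g :: s) x) ->
  (forall u, Q u /\ span s u -> P u /\ span s u) ->
  (forall a, (exists u, span s u /\ Q (a *: g + u)) ->
             exists u, span s u /\ P (a *: g + u)) ->
  forall x, Q x -> P x.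
Proof.
move=> sP sQ PQ Qspan QPs QPi x Qx.
have [a [u [su xE]]] := Qspan x Qx.
have [|v [sv Pv]] := QPi a; first by exists u; rewrite -xE.
have -> : x = (u - v) + (a *: g + v) by rewrite xE addrCA subrK.
apply: submoduleD => //.
apply: (QPs (u - v) _).1; split; last first.
  by apply: submoduleB => //; exact: span_submodule.
have -> : u - v = x - (a *: g + v) by rewrite xE opprD addrACA subrr add0r.
by apply: submoduleB => //; exact: PQ.
Qed.

Lemma chain_cond_span b (U : lmodType k) s (N : nat -> U -> Prop) :
  chain_cond k^o b -> (forall m, submodule (N m)) -> chain b N ->
  (forall m x, N m x -> span s x) -> stationary N.
Proof.
move=> cck; elim: s N => [|g s IHs] N sN cN Nspan.
  exists 0%N => p _ x; split=> /Nspan ->; by case: (sN 0%N) (sN p) => ? _ [].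
pose N1 m x := N m x /\ span s x.
pose I m (a : k^o) := exists u, span s u /\ N m (a *: g + u).
have [m1 N1st] : stationary N1.
  apply: IHs => [m|m x|m x []//].
    split; first by split; [case: (sN m) | case: (span_submodule s)].
    move=> a x y [Nx sx] [Ny sy].
    by split; [case: (sN m) => _; apply | case: (span_submodule s) => _; apply].
  by have := cN m x; rewrite /N1; case: b {cN cck} => h [/h].
have [m2 Ist] : stationary I.
  apply: cck => [m|m a].
    split; first by exists 0; rewrite scale0r add0r; split;
      [case: (span_submodule s) | case: (sN m)].
    move=> a b1 b2 [u [su Nu]] [v [sv Nv]]; exists (a *: u + v); split.
      by case: (span_submodule s) => _; apply.
    rewrite scalerDl -scalerA addrACA -scalerDr.
    by case: (sN m) => _; apply.
  by have := cN m; rewrite /I; case: b {cN IHs} => h [u [su /h]]; exists u.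
exists (maxn m1 m2) => p mp.
have [m1p m2p] : (m1 <= p)%N /\ (m2 <= p)%N by apply/andP; rewrite -geq_max.
set m := maxn m1 m2 in mp *.
have [m1m m2m] : (m1 <= m)%N /\ (m2 <= m)%N by rewrite leq_maxl leq_maxr.
have N1E u : N1 p u <-> N1 m u by rewrite N1st // N1st.
have IE a : I p a <-> I m a by rewrite Ist // Ist.
move=> x; have := @chain_le _ _ _ _ _ _ cN mp; case: b {cN cck IHs} => h;
  split; try exact: h.
  by apply: (sub_span_cons (sN p) (sN m) h (Nspan m)) => [u /N1E|a /IE].
by apply: (sub_span_cons (sN m) (sN p) h (Nspan p)) => [u /N1E|a /IE].
Qed.

Lemma chain_cond_fin_gen b (U : lmodType k) :
  chain_cond k^o b -> fin_gen U -> chain_cond U b.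
Proof.
move=> cck /fin_gen_span [s sU] N sN cN.
by apply: (chain_cond_span (s := s)) cN _.
Qed.

Lemma artinian_dcc : artinian k -> chain_cond k^o true.
Proof.
move=> kart N sN cN.
have [|m x|m mP] := kart N.
- move=> m; split=> [|x y|a x]; first by case: (sN m).
    exact: (@submoduleD _ k^o _ _ _ (sN m)).
  exact: (@submoduleZ _ k^o _ _ _ (sN m)).
- exact: (cN m x).
exists m => p mp x; split; last exact: mP.
exact: (@chain_le _ _ true _ _ _ cN).
Qed.

Lemma fin_gen_regular : fin_gen (k^o : lmodType k).
Proof.
apply/fin_gen_span; exists [:: 1] => x; exists x, 0; split=> //.
by rewrite addr0 /GRing.scale /= mulr1.
Qed.

End FinitelyGenerated.

(** * The minimal injective cogenerator *)

Section LinearMaps.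
Variables (k : comPzRingType).
Implicit Types (U V W J : lmodType k).

Definition linear_of U V (f : U -> V) (lin_f : linear f) : {linear U -> V} :=
  HB.pack f (GRing.isLinear.Build k U V *:%R f lin_f).

Lemma scale_at_linear U (u : U) : linear (fun a : k^o => a *: u).
Proof. by move=> a b c; rewrite scalerDl -scalerA. Qed.

Definition scale_at U (u : U) : {linear k^o -> U} :=
  linear_of (scale_at_linear u).

Lemma ker_submodule U V (f : {linear U -> V}) : submodule (fun x => f x = 0).
Proof.
split=> [|a x y fx fy]; first exact: linear0.
by rewrite linearP fx fy scaler0 addr0.
Qed.

Lemma im_submodule U V (f : {linear U -> V}) :
  submodule (fun x => exists y, x = f y).
Proof.
split=> [|a _ _ [x ->] [y ->]]; first by exists 0; rewrite linear0.
by exists (a *: x + y); rewrite linearP.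
Qed.

Lemma quotient_exists U (N : U -> Prop) : submodule N ->
  exists (W : lmodType k) (q : {linear U -> W}),
    (forall w, exists u, q u = w) /\ forall u, q u = 0 <-> N u.
Proof.
move=> [N0 Nl].
have sI : GRing.submod_closed (fun u => `[< N u >]).
  split=> [|a u v /asboolP Nu /asboolP Nv]; apply/asboolP => //; exact: Nl.
exists (quot_mod sI), (to_quot sI); split=> [w|u].
  by exists (of_quot w); exact: of_quotK.
rewrite -(linear0 (to_quot sI)) to_quotP subr0.
by split=> [/asboolP|Nu] //; apply/asboolP.
Qed.

Lemma fin_gen_quotient U W (q : {linear U -> W}) :
  (forall w, exists u, q u = w) -> fin_gen U -> fin_gen W.
Proof.
move=> qsurj [m [g gU]]; exists m, (q \o g) => w.
have [u <-] := qsurj w; have [c ->] := gU u.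
by exists c; rewrite linear_sum; apply: eq_bigr => i _; rewrite linearZ_LR.
Qed.

Lemma factor_quotient U V W (q : {linear U -> W}) (f : {linear U -> V}) :
  (forall w, exists u, q u = w) -> (forall u, q u = 0 -> f u = 0) ->
  exists g : {linear W -> V}, forall u, g (q u) = f u.
Proof.
move=> qsurj qf; have [r rK] := choice qsurj.
have fr u : f (r (q u)) = f u.
  by apply/eqP; rewrite -subr_eq0 -linearB qf // linearB /= rK subrr.
have lin_fr : linear (f \o r).
  move=> a x y /=; have [u <-] := qsurj x; have [v <-] := qsurj y.
  by rewrite -linearP !fr linearP.
by exists (linear_of lin_fr).
Qed.

Section InjectiveCogenerator.
Variable (J : lmodType k).

(** Injectivity of [J], applied to the monomorphism that [q] induces on the
    quotient of [U] by its kernel. *)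
Lemma extend_linear U W (q : {linear U -> W}) (f : {linear U -> J}) :
  injective_in_kmod J -> fin_gen U -> fin_gen W ->
  (forall u, q u = 0 -> f u = 0) ->
  exists g : {linear W -> J}, forall u, g (q u) = f u.
Proof.
move=> Jinj fU fW qf.
have [U' [p [psurj pker]]] := quotient_exists (ker_submodule q).
have [i iE] := factor_quotient psurj (fun u => (pker u).1).
have [h hE] := factor_quotient psurj (fun u pu => qf u ((pker u).1 pu)).
have iinj : injective i.
  move=> x y; have [u <-] := psurj x; have [v <-] := psurj y.
  rewrite !iE => quv; apply/eqP; rewrite -subr_eq0 -linearB; apply/eqP/pker.
  by rewrite linearB /= quv subrr.
have [g gE] := Jinj U' W (fin_gen_quotient psurj fU) fW i h iinj.
by exists g => u; rewrite -iE gE hE.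
Qed.

Lemma extend_cyclic W (w : W) (j : J) :
  injective_in_kmod J -> fin_gen W -> (forall a, a *: w = 0 -> a *: j = 0) ->
  exists g : {linear W -> J}, g w = j.
Proof.
move=> Jinj fW wj.
have [g gE] := @extend_linear _ _ (scale_at w) (scale_at j) Jinj
  (fin_gen_regular k) fW wj.
by exists g; have := gE 1; rewrite /= !scale1r.
Qed.

Lemma cogenerator_separates V (v : V) :
  cogenerator_in_kmod J -> fin_gen V -> v <> 0 ->
  exists h : {linear V -> J}, h v <> 0.
Proof.
move=> Jcog fV v0.
have [|h hP] := Jcog _ _ (fin_gen_regular k) fV (scale_at v)
  (\0 : {linear k^o -> V}).
  by move/(_ 1); rewrite /= scale1r.
exists h => hv; apply: hP => a.
by rewrite -[LHS]/(h (a *: v)) linearZ_LR hv scaler0 -[RHS]/(h 0) linear0.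
Qed.

(** Annihilators in [J] turn an ascending chain of ideals into a descending
    chain of submodules of [J], and the cogenerator recovers the ideals. *)
Lemma artinian_acc : artinian k -> injective_cogenerator J ->
  chain_cond k^o false.
Proof.
move=> kart [fJ _ Jcog] N sN cN.
pose A m (j : J) := forall a, N m a -> a *: j = 0.
have [|m j Aj a Na|m mP] := chain_cond_fin_gen (artinian_dcc kart) fJ (N := A).
- move=> m; split=> [a _|a x y Ax Ay b Nb]; first exact: scaler0.
  by rewrite scalerDr scalerA mulrC -scalerA Ax // Ay // scaler0 addr0.
- by apply: Aj; exact: (cN m).
exists m => p mp a; split=> [Npa|]; last exact: (chain_le cN mp).
apply: contrapT => nNma.
have [W [q [qsurj qker]]] := quotient_exists (sN m).
have [|h] := cogenerator_separates Jcog
  (fin_gen_quotient qsurj (fin_gen_regular k)) (v := q a).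
  by move/qker.
have hE b : h (q b) = b *: h (q 1).
  by rewrite -!linearZ_LR /= /GRing.scale /= mulr1.
rewrite hE; apply; have /(mP p mp) : A m (h (q 1)); last exact.
by move=> b /qker qb; rewrite -hE qb linear0.
Qed.

End InjectiveCogenerator.

Section MinimalInjectiveCogenerator.
Variable (J : lmodType k).
Hypotheses (k_artinian : artinian k) (J_min : minimal_injective_cogenerator J).

Let J_ic : injective_cogenerator J. Proof. by case: J_min. Qed.

Lemma fin_gen_dcc U : fin_gen U -> chain_cond U true.
Proof. exact/chain_cond_fin_gen/artinian_dcc. Qed.

Lemma fin_gen_acc U : fin_gen U -> chain_cond U false.
Proof. exact/chain_cond_fin_gen/(artinian_acc k_artinian J_ic). Qed.

(** If [g] is injective with least possible image, then [g \o f] has the same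
    image, and [g] cancels. *)
Lemma injective_endo_surjective (f : {linear J -> J}) :
  injective f -> forall x, exists y, x = f y.
Proof.
move=> finj x; have [fJ _ _] := J_ic.
pose F N := exists2 g : {linear J -> J},
  injective g & N = fun x => exists y, x = g y.
have [||_ [[g ginj ->] gmin]] := chain_cond_extremal (fin_gen_dcc fJ) (F := F).
- by move=> _ [g _ ->]; exact: im_submodule.
- by exists (fun x => exists y, x = f y), f.
have [|_ [y ->]|_] := gmin (fun x => exists y, x = (g \o f) y) _ _ (g x).
- by exists (g \o f : {linear J -> J}) => //; exact: inj_comp.
- by exists (f y).
by case=> [|y /ginj ->]; [exists x | exists y].
Qed.

(** If [j2] escaped [k j1], a submodule [Q] of [J] maximal among those
    containing [j2] but not [j1] would be a direct summand of [J] and again a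
    cogenerator, since whatever is lost with the complement of [Q], an essential
    extension of [k j1], is recovered through [j1 |-> j2].  By minimality [J]
    would embed into [Q], although injective endomorphisms of [J] are onto. *)
Lemma socle_multiplicity_free (j1 j2 : J) :
  j1 <> 0 -> (forall a, a *: j1 = 0 -> a *: j2 = 0) ->
  (forall a, a *: j1 <> 0 -> exists b, (b * a) *: j1 = j1) ->
  exists a, j2 = a *: j1.
Proof.
move=> j1_neq0 ann12 j1_simple; apply: contrapT => nj2.
have [fJ Jinj Jcog] := J_ic.
pose F N := [/\ @submodule k J N, N j2 & ~ N j1].
have [||Q [[sQ Qj2 nQj1] Qmax]] :=
    chain_cond_extremal (fin_gen_acc fJ) (F := F).
- by move=> N [].
- exists (fun x => exists a, x = scale_at j2 a); split.
  + exact: im_submodule.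
  + by exists 1; rewrite /= scale1r.
  move=> [a /= j1E].
  have [b bE] : exists b, (b * a) *: j1 = j1.
    by apply: j1_simple => /ann12 aj2; apply: j1_neq0; rewrite j1E.
  apply: nj2; exists b; rewrite j1E scalerA; apply/eqP.
  rewrite -subr_eq0 -[X in X - _]scale1r -scalerBl; apply/eqP/ann12.
  by rewrite scalerBl scale1r bE subrr.
have {Qmax} Qmax N : submodule N -> (forall x, Q x -> N x) -> ~ N j1 ->
    forall x, N x -> Q x.
  move=> sN QN nNj1 x; apply: (Qmax N _ QN x).1; split=> //; exact: QN.
(* Endomorphisms that kill [Q] and fix [j1] have kernel [Q], by maximality.
   One of least image maps this image onto itself, so it splits off [Q]. *)
have [th0 th0Q th0j1] : exists2 th : {linear J -> J},
    forall x, Q x -> th x = 0 & th j1 = j1.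
  have [W [q [qsurj qker]]] := quotient_exists sQ.
  have [|g gE] := @extend_cyclic J W (q j1) j1 Jinj (fin_gen_quotient qsurj fJ).
    move=> a; rewrite -linearZ_LR => /qker Qa; apply: contrapT.
    case/j1_simple => b bE; apply: nQj1; rewrite -bE -scalerA.
    exact: submoduleZ.
  by exists (g \o q : {linear J -> J}) => //= x /qker ->; exact: linear0.
pose G N := exists th : {linear J -> J},
  [/\ forall x, Q x -> th x = 0, th j1 = j1 & N = fun x => exists y, x = th y].
have [||_ [[th [thQ thj1 ->]] thmin]] :=
    chain_cond_extremal (fin_gen_dcc fJ) (F := G).
- by move=> _ [th [_ _ ->]]; exact: im_submodule.
- by exists (fun x => exists y, x = th0 y), th0.
have thK x : exists y, th x = th (th y).
  have [|_ [y ->]|_] := thmin (fun x => exists y, x = (th \o th) y) _ _ (th x).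
  - exists (th \o th : {linear J -> J}); split=> //= [y Qy|].
      by rewrite (thQ y Qy) linear0.
    by rewrite !thj1.
  - by exists (th y).
  by case=> [|y]; [exists x | exists y].
have th2Q x : th (th x) = 0 -> Q x.
  apply: (Qmax _ (ker_submodule (th \o th : {linear J -> J}))) => [y Qy|] /=.
    by rewrite (thQ y Qy) linear0.
  by rewrite !thj1.
have thker x : th x = 0 -> Q x by move=> thx; apply: th2Q; rewrite thx linear0.
have [r rE] := choice thK.
have imQ x : Q (th x) -> th x = 0 by move=> /thQ /th2Q /thQ.
(* The projection onto [Q] along the image of that endomorphism. *)
pose pi x := x - th (r x).
have Qpi x : Q (pi x) by apply: thker; rewrite linearB /= -rE subrr.
have lin_pi : linear pi.
  move=> a x y; apply/eqP; rewrite -subr_eq0.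
  have piE : pi (a *: x + y) - (a *: pi x + pi y) =
             th (a *: r x + r y - r (a *: x + y)).
    have -> : a *: pi x + pi y = a *: x + y - th (a *: r x + r y).
      by rewrite linearP /pi scalerBr addrACA -opprD.
    by rewrite opprB addrC addrA subrK linearB.
  apply/eqP; rewrite piE; apply: imQ; rewrite -piE; apply: submoduleB => //.
  by case: sQ => _; apply.
have piQ x : Q x -> pi x = x.
  move=> Qx; rewrite /pi -[RHS]subr0; congr (_ - _); apply: imQ.
  by rewrite -[th _](subKr x); exact: (submoduleB sQ Qx (Qpi x)).
have pi_th x : pi (th x) = 0.
  apply/eqP; rewrite /pi subr_eq0 -subr_eq0 -linearB; apply/eqP; apply: imQ.
  rewrite linearB; exact: Qpi.
have [rho rhoE] := extend_cyclic Jinj fJ ann12.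
(* The summand [Q], as a quotient of [J]. *)
have [W [q [qsurj qker]]] := quotient_exists (ker_submodule (linear_of lin_pi)).
have [i iE] := factor_quotient qsurj (fun u => (qker u).1).
have iK w : q (i w) = w.
  have [u <-] := qsurj w; apply/eqP; rewrite -subr_eq0 -linearB; apply/eqP/qker.
  by rewrite linearB iE /= piQ // subrr.
have fW := fin_gen_quotient qsurj fJ.
have W_ic : injective_cogenerator W.
  split=> //.
    move=> U V fU fV f g finj.
    have [h hE] := Jinj U V fU fV f (i \o g) finj.
    by exists (q \o h : {linear V -> W}) => u /=; rewrite hE /= iK.
  move=> U V fU fV f g fg.
  have [u fgu] : exists u, f u - g u <> 0.
    apply: contrapT => nex; apply: fg => u; apply/eqP; rewrite -subr_eq0.
    by apply/eqP; apply: contrapT => fgu; apply: nex; exists u.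
  have [h hv] := cogenerator_separates Jcog fV fgu.
  suff [h' h'v] : exists h' : {linear V -> J}, pi (h' (f u - g u)) <> 0.
    exists (q \o h' : {linear V -> W}) => h'fg; apply: h'v.
    apply/(qker (h' (f u - g u))); rewrite linearB linearB; apply/eqP.
    rewrite subr_eq0; apply/eqP; exact: (h'fg u).
  have [pihv|] := EM (pi (h (f u - g u)) = 0); last by exists h.
  set x := h _ in hv pihv.
  pose Qx z := exists a, Q (z - a *: x).
  (* [x] lies in the complement of [Q], whose nonzero submodules contain
     [j1]. *)
  have [a Qa] : Qx j1.
    have xE : x = th (r x) by apply/eqP; rewrite -subr_eq0; apply/eqP.
    apply: contrapT => nQxj1; apply: hv; rewrite [LHS]xE; apply: imQ.
    rewrite -xE.
    apply: (Qmax Qx) => //; last by exists 1; rewrite scale1r subrr; case: sQ.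
      split; first by exists 0; rewrite scale0r subr0; case: sQ.
      move=> a y z [b Qb] [c Qc]; exists (a * b + c).
      rewrite scalerDl opprD addrACA -scalerA -scalerBr.
      by case: sQ => _; apply.
    by move=> y Qy; exists 0; rewrite scale0r subr0.
  have j1E : j1 = a *: x.
    apply/eqP; rewrite -subr_eq0 -(piQ _ Qa) -[pi _]/(linear_of lin_pi _).
    rewrite linearB linearZ_LR /= pihv scaler0 subr0.
    by rewrite -{1}thj1 pi_th.
  exists (rho \o h : {linear V -> J}) => /= pirho; apply: j1_neq0.
  have j2E : j2 = 0.
    rewrite -(piQ _ Qj2) -rhoE j1E linearZ_LR -[pi _]/(linear_of lin_pi _).
    by rewrite linearZ_LR /= pirho scaler0.
  by case: nj2; exists 0; rewrite scale0r.
have [_ /(_ W W_ic) [e einj]] := J_min.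
have [|y j1E] := injective_endo_surjective (f := i \o e) _ j1.
  by apply: inj_comp => //; exact: can_inj iK.
apply: nQj1; rewrite j1E /=; have [u <-] := qsurj (e y); rewrite iE.
exact: Qpi.
Qed.

(** Double annihilators: [Hom(M, J)] has no more submodules than [M].
    Induction on the length of [M] over the common kernel of [S]; one simple
    step, spanned by [v], is undone by one functional [s0] with [s0 v <> 0],
    because [J] has room for only one copy of each simple module. *)
Lemma submodule_double_perp M (S : hom_mod M J -> Prop) (phi : hom_mod M J) :
  fin_gen M -> submodule S ->
  (forall x, (forall s, S s -> hom_mod_fun s x = 0) -> hom_mod_fun phi x = 0) ->
  S phi.
Proof.
move=> fM; pose perp (T : hom_mod M J -> Prop) x :=
  forall s, T s -> hom_mod_fun s x = 0.
have funZ a (s : hom_mod M J) x : hom_mod_fun (a *: s) x = a *: hom_mod_fun s x.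
  by [].
have funB (s t : hom_mod M J) x :
  hom_mod_fun (s - t) x = hom_mod_fun s x - hom_mod_fun t x by [].
have funlB (s : hom_mod M J) x y :
  hom_mod_fun s (x - y) = hom_mod_fun s x - hom_mod_fun s y by exact: linearB.
have funlZ (s : hom_mod M J) a x :
  hom_mod_fun s (a *: x) = a *: hom_mod_fun s x by exact: linearZ_LR.
have perp_sub T : submodule (perp T).
  split=> [s _|a x y Tx Ty s Ts]; first exact: linear0.
  rewrite /hom_mod_fun linearP [X in _ *: X]Tx // [X in _ + X]Ty //.
  by rewrite scaler0 addr0.
have [l cl] : exists l, colength_le l (perp S).
  by apply: finite_colength => //; [exact: fin_gen_dcc | exact: fin_gen_acc].
elim: l S phi cl => [|l IHl] S phi /= cS sS phiP.
  suff -> : phi = 0 by case: sS.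
  by apply: hom_modP => x; rewrite phiP // => s; exact: cS.
have [K1 [sK1 SK1 smallK1 cK1]] := cS.
have [SK1E|nSK1] := EM (forall x, K1 x -> perp S x).
  by apply: IHl => //; exact: colength_le_mono cK1.
have [v [s0 [K1v Ss0 s0v]]] :
    exists v s0, [/\ K1 v, S s0 & hom_mod_fun s0 v <> 0].
  apply: contrapT => nex; apply: nSK1 => x K1x s Ss; apply: contrapT => sx.
  by apply: nex; exists x, s.
have simple_s0v a : a *: hom_mod_fun s0 v <> 0 ->
    exists b, (b * a) *: hom_mod_fun s0 v = hom_mod_fun s0 v.
  move=> s0a; have K1a : K1 (a *: v) by exact: submoduleZ.
  have [|b Sb] := smallK1 _ v K1a K1v.
    by move/(_ s0 Ss0); rewrite funlZ.
  exists b; have /eqP := Sb s0 Ss0; rewrite funlB !funlZ scalerA subr_eq0.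
  by move=> /eqP.
have multiple (t : hom_mod M J) : (forall x, perp S x -> hom_mod_fun t x = 0) ->
    exists a, hom_mod_fun t v = a *: hom_mod_fun s0 v.
  move=> tS; apply: socle_multiplicity_free => // a s0a.
  apply: contrapT; rewrite -funlZ => ta.
  have K1a : K1 (a *: v) by exact: submoduleZ.
  have [|b Sb] := smallK1 _ v K1a K1v; first by move/tS.
  by apply: s0v; have := Sb s0 Ss0; rewrite funlB !funlZ s0a scaler0 subr0.
pose S1 s := S s /\ hom_mod_fun s v = 0.
have sS1 : submodule S1.
  split; first by split=> //; case: sS.
  move=> a s t [Ss sv] [St tv]; split; first by case: sS => _; apply.
  rewrite -[LHS]/(a *: hom_mod_fun s v + hom_mod_fun t v) sv tv.
  by rewrite scaler0 addr0.
have cS1 : colength_le l (perp S1).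
  apply: colength_le_mono cK1 => // x K1x s [Ss sv].
  have nSv : ~ perp S v by move/(_ s0 Ss0).
  have [a /(_ s Ss)] := smallK1 v x K1v K1x nSv.
  by rewrite funlB funlZ sv scaler0 subr0.
have [a phiv] := multiple phi phiP.
(* The functionals in [S] that kill [v] are covered by the induction; it remains
   to see that their common kernel is no larger than [perp S + k v]. *)
suff : S1 (phi - a *: s0).
  move=> [S1phi _]; rewrite -(subrK (a *: s0) phi).
  by apply: submoduleD => //; exact: submoduleZ.
apply: IHl => // x S1x.
have [b s0x] : exists b, hom_mod_fun s0 x = b *: hom_mod_fun s0 v.
  apply: socle_multiplicity_free => // c s0c.
  rewrite -funZ; apply: S1x; split; first exact: submoduleZ.
  by rewrite funZ.
have Sxv : perp S (x - b *: v).
  move=> t St; have [|c tv] := multiple t; first by move=> y; apply.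
  have : S1 (t - c *: s0).
    split; last by rewrite funB funZ tv subrr.
    by apply: submoduleB => //; exact: submoduleZ.
  move/S1x/eqP; rewrite funB funZ subr_eq0 => /eqP tx.
  by rewrite funlB funlZ tx tv s0x !scalerA mulrC subrr.
have /eqP := phiP _ Sxv; rewrite funlB funlZ subr_eq0 => /eqP phix.
by rewrite funB funZ phix phiv s0x !scalerA mulrC subrr.
Qed.

End MinimalInjectiveCogenerator.
End LinearMaps.

(** * Local summands and the radical *)

Section LinearCategories.
Variables (k : comPzRingType) (C : lincat k).
Implicit Types (A B P Q X Y Z L T : C).

Lemma mcompBl A B Z (g g' : mor B Z) (f : mor A B) :
  (g - g') ∘ f = g ∘ f - g' ∘ f.
Proof. by rewrite mcompDl mcompNl. Qed.

Lemma mcompBr A B Z (g : mor B Z) (f f' : mor A B) :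
  g ∘ (f - f') = g ∘ f - g ∘ f'.
Proof. by rewrite mcompDr mcompNr. Qed.

Lemma iso_id A : is_iso (idm A).
Proof. by exists (idm A); rewrite mcomp1m. Qed.

Lemma iso_comp A B Z (g : mor B Z) (f : mor A B) :
  is_iso g -> is_iso f -> is_iso (g ∘ f).
Proof.
move=> [g' [g'g gg']] [f' [f'f ff']]; exists (f' ∘ g'); split.
  by rewrite mcompA -(mcompA f') g'g mcompm1.
by rewrite mcompA -(mcompA g) ff' mcompm1.
Qed.

Lemma iso_of_inverses A B (f : mor A B) (l r : mor B A) :
  l ∘ f = idm A -> f ∘ r = idm B -> is_iso f.
Proof.
move=> lf fr; exists l; split=> //.
by rewrite -[l]mcompm1 -fr (mcompA l) lf mcomp1m.
Qed.

(** [1 + g (1 - f g)^-1 f] inverts [1 - g f]. *)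
Lemma inverse_1B_swap A B (f : mor A B) (g : mor B A) (t : mor B B) :
  t ∘ (idm B - f ∘ g) = idm B -> (idm B - f ∘ g) ∘ t = idm B ->
  (idm A + g ∘ t ∘ f) ∘ (idm A - g ∘ f) = idm A /\
  (idm A - g ∘ f) ∘ (idm A + g ∘ t ∘ f) = idm A.
Proof.
rewrite mcompBr mcompBl mcomp1m mcompm1 => tE Et; split.
  rewrite mcompBr mcompm1 mcompDl mcomp1m.
  have -> : g ∘ t ∘ f ∘ (g ∘ f) = g ∘ t ∘ f - g ∘ f.
    rewrite -[X in _ - X ∘ f]mcompm1 -tE mcompBr mcompBl subKr.
    by rewrite !mcompA.
  by rewrite [g ∘ f + _]addrC subrK addrK.
rewrite mcompDr mcompm1 mcompBl mcomp1m.
have -> : g ∘ f ∘ (g ∘ t ∘ f) = g ∘ t ∘ f - g ∘ f.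
  rewrite -[X in _ - X ∘ f]mcompm1 -Et mcompBr mcompBl subKr.
  by rewrite !mcompA.
by rewrite opprB [_ ∘ f + (_ - _)]addrC subrK subrK.
Qed.

Lemma iso_1B_swap A B (f : mor A B) (g : mor B A) :
  is_iso (idm B - f ∘ g) -> is_iso (idm A - g ∘ f).
Proof. by move=> [t [tE Et]]; eexists; exact: inverse_1B_swap tE Et. Qed.

Lemma rad_compl A B Z (g : mor B Z) (f : mor A B) : rad f -> rad (g ∘ f).
Proof. by move=> radf h; rewrite mcompA. Qed.

Lemma rad_compr A B Z (g : mor B Z) (f : mor A B) : rad g -> rad (g ∘ f).
Proof. by move=> radg h; rewrite mcompA; apply: iso_1B_swap; rewrite mcompA. Qed.

Lemma rad_iso_1Br A B (f : mor A B) (g : mor B A) :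
  rad f -> is_iso (idm B - f ∘ g).
Proof. by move=> radf; apply: iso_1B_swap. Qed.

Lemma local_iso_1B A (f : mor A A) :
  local_end A -> ~ is_iso f -> is_iso (idm A - f).
Proof.
move=> [_ locA] nf; have [|//|//] := locA (idm A - f) f.
by rewrite subrK; exact: iso_id.
Qed.

(** A composite [f g] in [End(B)] cannot be invertible, so [1 - f g] is. *)
Lemma local_rad_epi X B (f : mor X B) :
  local_end B -> ~ split_epi f -> rad f.
Proof.
move=> locB nf g; apply: iso_1B_swap; apply: local_iso_1B => // -[h [_ fgh]].
by apply: nf; exists (g ∘ h); rewrite mcompA.
Qed.

Lemma local_rad_mono A X (f : mor A X) :
  local_end A -> ~ split_mono f -> rad f.
Proof.
move=> locA nf g; apply: local_iso_1B => // -[h [hgf _]].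
by apply: nf; exists (h ∘ g); rewrite -mcompA.
Qed.

(** The idempotent of [End(B)] with image [A] is invertible or has an invertible
    complement; the latter would make [s] zero. *)
Lemma local_iso_of_retract A B (s : mor A B) (r : mor B A) :
  ~ is_zero A -> local_end B -> is_iso (r ∘ s) -> is_iso s.
Proof.
move=> nA [_ locB] [u [urs _]].
have r's : (u ∘ r) ∘ s = idm A by rewrite -mcompA.
have [|[t [_ st]]|[t [ts _]]] :=
    locB (s ∘ (u ∘ r)) (idm B - s ∘ (u ∘ r)).
- by rewrite addrC subrK; exact: iso_id.
- by apply: (iso_of_inverses (r := u ∘ r ∘ t) r's); rewrite mcompA.
exfalso; apply: nA; rewrite /is_zero -r's.
suff -> : s = 0 by rewrite mcompm0.
rewrite -[s]mcomp1m -ts -mcompA mcompBl mcomp1m -(mcompA s) r's mcompm1.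
by rewrite subrr mcompm0.
Qed.

Lemma local_end_iso A B (s : mor A B) (r : mor B A) :
  r ∘ s = idm A -> s ∘ r = idm B -> local_end A -> local_end B.
Proof.
move=> rs sr [nA locA].
have conj (f : mor B B) : is_iso (r ∘ f ∘ s) <-> is_iso f.
  have isor : is_iso r by exists s.
  have isos : is_iso s by exists r.
  split=> [isof|isof]; last by apply: iso_comp => //; exact: iso_comp.
  have -> : f = s ∘ (r ∘ f ∘ s) ∘ r.
    by rewrite !mcompA sr mcomp1m -mcompA sr mcompm1.
  by apply: iso_comp => //; exact: iso_comp.
split=> [B0|f g].
  by apply: nA; rewrite /is_zero -rs -[s]mcomp1m B0 mcomp0m mcompm0.
move/conj; rewrite mcompDr mcompDl => /locA [] /conj; by [left | right].
Qed.

(** The equations [r ∘ i = 0] and [p ∘ s = 0] follow from these three. *)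
Definition biproduct X A B (s : mor A X) (r : mor X A) (i : mor B X)
    (p : mor X B) : Prop :=
  [/\ r ∘ s = idm A, p ∘ i = idm B & s ∘ r + i ∘ p = idm X].

Lemma biproduct_cross X A B (s : mor A X) r (i : mor B X) p :
  biproduct s r i p -> r ∘ i = 0 /\ p ∘ s = 0.
Proof.
move=> [rs pi sum]; split.
  have /eqP : r ∘ (s ∘ r + i ∘ p) = r by rewrite sum mcompm1.
  rewrite mcompDr !mcompA rs mcomp1m addrC -subr_eq0 addrK => /eqP ripE.
  by rewrite -[LHS]mcompm1 -pi mcompA ripE mcomp0m.
have /eqP : p ∘ (s ∘ r + i ∘ p) = p by rewrite sum mcompm1.
rewrite mcompDr !mcompA pi mcomp1m -subr_eq0 addrK => /eqP psrE.
by rewrite -[LHS]mcompm1 -rs mcompA psrE mcomp0m.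
Qed.

(** The summands are split off one at a time, which suits induction on [m];
    uniqueness of the decomposition does not enter, only the exchange below. *)
Fixpoint local_sum (m : nat) X : Prop :=
  if m is m'.+1 then
    exists B X' (s : mor B X) r (i : mor X' X) p,
      [/\ local_end B, biproduct s r i p & local_sum m' X']
  else is_zero X.

(** [N] is the kernel of [t], and [t] is an isomorphism on [B]: so [N] is a
    complement of [B] too. *)
Lemma complement_change X B D N (s : mor B X) (r : mor X B) (sg : mor D X) t
    (q : mor N X) p :
  r ∘ s = idm B -> biproduct sg t q p -> is_iso (t ∘ s) ->
  exists (q' : mor N X) p', biproduct s r q' p'.
Proof.
move=> rs sgt [u [uts tsu]].
have [tq psg] := biproduct_cross sgt; have [tsg pq sum] := sgt.
exists ((idm X - s ∘ r) ∘ q), (p ∘ (idm X - s ∘ u ∘ t)).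
have kill_s : (idm X - s ∘ u ∘ t) ∘ s = 0.
  by rewrite mcompBl mcomp1m -!mcompA uts mcompm1 subrr.
split=> //.
  have E : (idm X - s ∘ u ∘ t) ∘ (idm X - s ∘ r) = idm X - s ∘ u ∘ t.
    by rewrite mcompBr mcompm1 mcompA kill_s mcomp0m subr0.
  rewrite -mcompA (mcompA _ _ q) E mcompBl mcomp1m -mcompA tq mcompm0 subr0.
  exact: pq.
rewrite -(mcompA (idm X - s ∘ r) q) (mcompA q).
have -> : q ∘ p = idm X - sg ∘ t by rewrite -sum addrAC subrr add0r.
have -> : (idm X - sg ∘ t) ∘ (idm X - s ∘ u ∘ t) = idm X - s ∘ u ∘ t.
  rewrite mcompBl mcomp1m mcompBr mcompm1.
  have -> : sg ∘ t ∘ (s ∘ u ∘ t) = sg ∘ t.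
    by rewrite !mcompA -(mcompA sg) -(mcompA sg) tsu mcompm1.
  by rewrite subrr subr0.
rewrite mcompBl mcomp1m.
have -> : s ∘ r ∘ (idm X - s ∘ u ∘ t) = s ∘ r - s ∘ u ∘ t.
  rewrite mcompBr mcompm1; congr (_ - _).
  by rewrite -!mcompA (mcompA r) rs mcomp1m.
by rewrite addrC -addrA opprB subrK subrK.
Qed.

(** For [X = B ⊕ X'] with [B] local, the corner of [1 - x] at [B] is invertible,
    and its Schur complement is [1 - y] where [y] inherits the hypothesis on
    [x]. *)
Lemma iso_1B_of_thin m X (x : mor X X) : local_sum m X ->
  (forall B (s : mor B X) (q : mor X B),
     local_end B -> ~ is_iso (q ∘ x ∘ s)) ->
  is_iso (idm X - x).
Proof.
elim: m X x => [|m IHm] X x /=.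
  move=> X0 _; exists 0; split; last by rewrite mcompm0 X0.
  by rewrite mcomp0m X0.
move=> [B [X' [s [r [i [p [locB [rs pi sum] sX']]]]]]] thin.
have [t [tE Et]] := local_iso_1B locB (thin B s r locB).
have [] := @inverse_1B_swap X B r (x ∘ s) t; rewrite ?mcompA //.
set v := _ + _ => vE Ev.
have -> : idm X - x = (idm X - x ∘ s ∘ r) ∘ (idm X - v ∘ x ∘ i ∘ p).
  rewrite mcompBr mcompm1 !mcompA Ev mcomp1m -addrA -opprD; congr (_ - _).
  by rewrite -[LHS]mcompm1 -sum mcompDr !mcompA.
apply: iso_comp; first by exists v.
apply: iso_1B_swap; rewrite !mcompA; apply: (IHm) => // B' s' q' locB'.
have -> : q' ∘ (p ∘ v ∘ x ∘ i) ∘ s' =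
    (q' ∘ p) ∘ x ∘ (i ∘ s') + (q' ∘ p) ∘ x ∘ (s ∘ t ∘ r ∘ x ∘ i ∘ s').
  by rewrite /v !(mcompDl, mcompDr, mcompm1) !mcompA.
by case: locB' => nB' locB' /locB' [] /thin; apply.
Qed.

Lemma nonrad_local_summand m X Y (d : mor X Y) : local_sum m X -> ~ rad d ->
  exists B (s : mor B X) (g : mor Y B), local_end B /\ g ∘ d ∘ s = idm B.
Proof.
move=> sX nd; apply: contrapT => nex; apply: nd => g.
apply: iso_1B_of_thin sX _ => B s q locB [u [uE _]].
apply: nex; exists B, s, (u ∘ q ∘ g); split=> //.
by rewrite -!mcompA in uE *.
Qed.

End LinearCategories.

Section KrullSchmidt.
Variables (k : comPzRingType) (C : addcat k).
Implicit Types (A B X Y : C).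

Lemma dsum_biproduct A B :
  biproduct (in1 : mor A (A ⊕ B)) pr1 (in2 : mor B (A ⊕ B)) pr2.
Proof. by split; [exact: pr1_in1 | exact: pr2_in2 | exact: in_pr]. Qed.

Lemma krull_schmidt_local_sum : krull_schmidt C ->
  forall X, exists m, local_sum m X.
Proof.
move=> ksC X; have [m [B [locB isoX]]] := ksC X; exists m.
elim: m B locB X isoX => [|m IHm] B locB X [f [g [gf fg]]] /=.
  move: f g gf fg; rewrite big_ord0 => f g gf _.
  by rewrite /is_zero -gf -[f]mcomp1m zero_objP mcomp0m mcompm0.
move: f g gf fg; rewrite big_ord_recl.
set S := \big[_/_]_(i < m) _ => f g gf fg.
exists (B ord0), S, (g ∘ in1), (pr1 ∘ f), (g ∘ in2), (pr2 ∘ f).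
split=> //.
  split.
  - by rewrite -!mcompA (mcompA f) fg mcomp1m pr1_in1.
  - by rewrite -!mcompA (mcompA f) fg mcomp1m pr2_in2.
  - by rewrite !mcompA -mcompDl -!(mcompA g) -mcompDr in_pr mcompm1.
by apply: (IHm (fun i => B (lift ord0 i))) => //; exists (idm S); exact: iso_id.
Qed.

Lemma indecomposable_local X :
  krull_schmidt C -> indecomposable X -> local_end X.
Proof.
move=> ksC [nX indecX]; have [[|m] //] := krull_schmidt_local_sum ksC X.
move=> [B [X' [s [r [i [p [locB [rs pi sum] _]]]]]]].
have [ri ps] := biproduct_cross (And3 rs pi sum).
have [|B0|X'0] := indecX B X'.
- exists (colm r p), (rowm s i); rewrite rowm_colm; split=> //.
  rewrite colm_comp !comp_rowm rs ri ps pi /colm /rowm !mcomp0m addr0 add0r.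
  by rewrite !mcomp1m in_pr.
- by case: locB.
apply: (local_end_iso (s := s) (r := r)) => //.
by rewrite -sum -[p]mcomp1m X'0 mcomp0m mcompm0 addr0.
Qed.

(** Exchange: [1 = r ∘ s] decomposes over the summands of [X], one of its
    components is invertible because [B] is local, and [B] takes the place of
    that summand. *)
Lemma local_exchange m X B (s : mor B X) (r : mor X B) :
  local_sum m X -> local_end B -> r ∘ s = idm B ->
  exists m' N (i : mor N X) p,
    [/\ m = m'.+1, local_sum m' N & biproduct s r i p].
Proof.
elim: m X s r => [|m IHm] X s r /=.
  move=> X0 [nB _] rs; case: nB.
  by rewrite /is_zero -rs -[s]mcomp1m X0 mcomp0m mcompm0.
move=> [B0 [X' [s0 [r0 [i [p [locB0 bX sX']]]]]]] locB rs.
have [rs0 pi sum] := bX; have [ri ps] := biproduct_cross bX.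
have [nB locB'] := locB.
have [|iso0|iso1] := locB' (r ∘ s0 ∘ (r0 ∘ s)) (r ∘ i ∘ (p ∘ s)).
- have -> : r ∘ s0 ∘ (r0 ∘ s) + r ∘ i ∘ (p ∘ s) = idm B.
    by rewrite !mcompA -mcompDl -!(mcompA r) -mcompDr sum mcompm1.
  exact: iso_id.
- have iso_r0s := local_iso_of_retract nB locB0 iso0.
  have [q' [p' bX']] := complement_change rs bX iso_r0s.
  by exists m, X', q', p'.
have [u [uE Eu]] := iso1.
have rs' : (u ∘ (r ∘ i)) ∘ (p ∘ s) = idm B by rewrite -mcompA.
have [m' [N [j [q [-> sN [_ qj sum']]]]]] := IHm X' (p ∘ s) _ sX' locB rs'.
have [_ qps] := biproduct_cross (And3 rs' qj sum').
have bN : biproduct (i ∘ (p ∘ s)) (u ∘ (r ∘ i) ∘ p) (rowm s0 (i ∘ j))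
    (colm r0 (q ∘ p)).
  split.
  - by rewrite -mcompA (mcompA p) pi mcomp1m.
  - rewrite colm_comp !comp_rowm rs0 mcompA ri mcomp0m -!mcompA ps mcompm0.
    rewrite (mcompA p) pi mcomp1m qj /colm /rowm !mcomp0m addr0 add0r.
    by rewrite !mcomp1m in_pr.
  rewrite rowm_colm addrCA -[RHS]sum; congr (_ + _).
  rewrite -!(mcompA i) -mcompDr (mcompA _ _ p) (mcompA j) -mcompDl sum' mcomp1m.
  by [].
have isoB : is_iso ((u ∘ (r ∘ i) ∘ p) ∘ s).
  by rewrite -mcompA rs'; exact: iso_id.
have [q' [p' bX']] := complement_change rs bN isoB.
exists m'.+1, (B0 ⊕ N), q', p'; split=> //.
by exists B0, N, in1, pr1, in2, pr2; split=> //; exact: dsum_biproduct.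
Qed.

End KrullSchmidt.

(** * Complexes up to homotopy *)

Section Homotopy.
Variables (k : comPzRingType) (C : lincat k) (n : nat).

Lemma eqm_id (A : C) (e : A = A) : eqm e = idm A.
Proof. by rewrite (Prop_irrelevance e erefl). Qed.

Lemma eqm_comp (A B Z : C) (e : A = B) (e' : B = Z) :
  eqm e' ∘ eqm e = eqm (etrans e e').
Proof. by case: _ / e'; rewrite /= mcomp1m. Qed.

Lemma eqmK (A B : C) (e : A = B) : eqm (esym e) ∘ eqm e = idm A.
Proof. by rewrite eqm_comp eqm_id. Qed.

Section TwoComplexes.
Variables (A B : C).
Implicit Types (X Y Z : cplx n A B).

Definition chain_id X : chain_map X X.
Proof. by exists (fun i => idm (X i)) => i _; rewrite mcomp1m mcompm1. Defined.

Definition chain_comp X Y Z (g : chain_map Y Z) (f : chain_map X Y) :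
  chain_map X Z.
Proof.
exists (fun i => g i ∘ f i) => i lein.
by rewrite mcompA -(cmapP g lein) -!mcompA (cmapP f lein).
Defined.

Lemma has_ends_id X : has_ends (idm A) (idm B) (chain_id X).
Proof. by split; rewrite /= mcomp1m mcompm1. Qed.

Lemma has_ends_comp X Y Z (g : chain_map Y Z) (f : chain_map X Y) :
  has_ends (idm A) (idm B) g -> has_ends (idm A) (idm B) f ->
  has_ends (idm A) (idm B) (chain_comp g f).
Proof.
move=> [g0 gn] [f0 fn].
rewrite /has_ends /= !(mcompm1, mcomp1m) in g0 gn f0 fn *.
by split; [rewrite -mcompA f0 | rewrite mcompA gn].
Qed.

Lemma homotopic_conj X Y Z (f : chain_map X Y) (g : chain_map Y X)
    (f' : chain_map Y Z) (g' : chain_map Z Y) :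
  homotopic (fun i => g i ∘ f i) (fun i => idm (X i)) ->
  homotopic (fun i => g' i ∘ f' i) (fun i => idm (Y i)) ->
  homotopic (fun i => chain_comp g g' i ∘ chain_comp f' f i)
    (fun i => idm (X i)).
Proof.
move=> [h [h0 hE hn]] [h' [h'0 h'E h'n]].
exists (fun i => h i + g i ∘ h' i ∘ f i.+1); split=> [|i ltin|].
- rewrite mcompDl h0 add0r -mcompA cmapP // mcompA -(mcompA (g 0%N)) h'0.
  by rewrite mcompm0 mcomp0m.
- have le1n : (i.+1 <= n)%N by [].
  rewrite /= -[idm _](subrK (g i.+1 ∘ f i.+1)) -addrA hE //.
  have -> : g i.+1 ∘ f i.+1 - g i.+1 ∘ g' i.+1 ∘ (f' i.+1 ∘ f i.+1) =
      g i.+1 ∘ (idm _ - g' i.+1 ∘ f' i.+1) ∘ f i.+1.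
    by rewrite mcompBr mcompBl mcompm1 !mcompA.
  rewrite h'E // !mcompDr !mcompDl addrACA; congr (_ + _ + (_ + _)).
    by rewrite !mcompA (cmapP g (ltnW ltin)).
  by rewrite -!mcompA (cmapP f le1n).
- rewrite mcompDr hn add0r !mcompA -(cmapP g (leqnn n)).
  by rewrite -(mcompA (g n.+1)) h'n mcompm0 mcomp0m.
Qed.

Lemma homotopy_equivalent_refl X : homotopy_equivalent X X.
Proof.
have id_id : homotopic (fun i => chain_id X i ∘ chain_id X i)
    (fun i => idm (X i)).
  exists (fun=> 0); split=> [|i _|] /=; rewrite ?mcomp0m ?mcompm0 //.
  by rewrite mcomp1m subrr addr0.
by exists (chain_id X), (chain_id X); split=> //; exact: has_ends_id.
Qed.

Lemma homotopy_equivalent_trans X Y Z :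
  homotopy_equivalent X Y -> homotopy_equivalent Y Z -> homotopy_equivalent X Z.
Proof.
move=> [f [g [ef eg gf fg]]] [f' [g' [ef' eg' gf' fg']]].
exists (chain_comp f' f), (chain_comp g g').
by split; [exact: has_ends_comp | exact: has_ends_comp
  | exact: homotopic_conj | exact: homotopic_conj].
Qed.

End TwoComplexes.

(** Data rather than an existence statement, so that a family of retracts of the
    terms of a complex can be changed at single indices. *)
Record retract (P : C) := Retract {
  ret_ob : C;
  ret_pr : mor P ret_ob;
  ret_in : mor ret_ob P;
  ret_inK : ret_pr ∘ ret_in = idm ret_ob
}.

Definition full_retract P := Retract (mcomp1m (idm P)).

(** The idempotents [1 - ret_in ∘ ret_pr] are the boundary of [H] and so commute
    with the differentials; hence so do the retractions and the inclusions, once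
    the retracts carry the differentials [ret_pr ∘ d ∘ ret_in]. *)
Lemma deformation_retract (A B : C) (X : cplx n A B)
    (S : forall j, retract (X j)) (H : forall j, mor (X j.+1) (X j)) :
  S 0%N = full_retract (X 0%N) -> S n.+1 = full_retract (X n.+1) ->
  H 0%N = 0 -> H n = 0 ->
  (forall j, (j < n)%N -> idm (X j.+1) - ret_in (S j.+1) ∘ ret_pr (S j.+1) =
     cdiff X j ∘ H j + H j.+1 ∘ cdiff X j.+1) ->
  exists Y : cplx n A B, homotopy_equivalent X Y /\
    forall j, Y j = ret_ob (S j).
Proof.
move=> S0 Sn H0 Hn HE.
have [e0 [p0E q0E]] : exists e : X 0%N = ret_ob (S 0%N),
    ret_pr (S 0%N) = eqm e /\ ret_in (S 0%N) = eqm (esym e).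
  by rewrite S0; exists erefl.
have [en [pnE qnE]] : exists e : X n.+1 = ret_ob (S n.+1),
    ret_pr (S n.+1) = eqm e /\ ret_in (S n.+1) = eqm (esym e).
  by rewrite Sn; exists erefl.
pose p j := ret_pr (S j); pose q j := ret_in (S j).
have pq j : p j ∘ q j = idm (ret_ob (S j)) := ret_inK (S j).
pose e j := idm (X j) - q j ∘ p j.
have pe j : p j ∘ e j = 0 by rewrite mcompBr mcompm1 mcompA pq mcomp1m subrr.
have eq j : e j ∘ q j = 0 by rewrite mcompBl mcomp1m -mcompA pq mcompm1 subrr.
have ed j : (j <= n)%N -> e j.+1 ∘ cdiff X j = cdiff X j ∘ e j.
  move=> lejn; transitivity (cdiff X j ∘ H j ∘ cdiff X j).
    move: lejn; rewrite leq_eqVlt => /predU1P [->|ltjn].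
      by rewrite /e /p /q Sn /= mcomp1m subrr Hn mcompm0.
    by rewrite /e HE // mcompDl -(mcompA (H j.+1)) cdiff_cdiff // mcompm0 addr0.
  case: j lejn => [|j] ltjn.
    by rewrite /e /p /q S0 /= mcomp1m subrr H0 mcompm0 mcomp0m mcompm0.
  by rewrite /e HE // mcompDr mcompA cdiff_cdiff // mcomp0m add0r mcompA.
have pd j : (j <= n)%N -> p j.+1 ∘ cdiff X j ∘ q j ∘ p j = p j.+1 ∘ cdiff X j.
  move=> lejn; apply/eqP; rewrite eq_sym -subr_eq0 -mcompA.
  rewrite -[X in X - _]mcompm1 -mcompBr -mcompA -[idm _ - _]/(e j) -ed //.
  by rewrite mcompA pe mcomp0m.
have dq j : (j <= n)%N ->
    q j.+1 ∘ (p j.+1 ∘ cdiff X j ∘ q j) = cdiff X j ∘ q j.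
  move=> lejn; apply/eqP; rewrite eq_sym -subr_eq0 -mcompA mcompA.
  rewrite -[X in X - _]mcomp1m -mcompBl -[idm _ - _]/(e j.+1) mcompA ed //.
  by rewrite -mcompA eq mcompm0.
have dd j : (j < n)%N ->
    (p j.+2 ∘ cdiff X j.+1 ∘ q j.+1) ∘ (p j.+1 ∘ cdiff X j ∘ q j) = 0.
  move=> ltjn; rewrite -mcompA dq ?(ltnW ltjn) // -!mcompA (mcompA _ _ (q j)).
  by rewrite cdiff_cdiff // mcomp0m mcompm0.
pose Y := @Cplx k C n A B (fun j => ret_ob (S j))
  (fun j => p j.+1 ∘ cdiff X j ∘ q j)
  (etrans (esym e0) (cob_first X)) (etrans (esym en) (cob_last X)) dd.
pose f : chain_map X Y := @ChainMap k C n A B A B X Y p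
  (fun j lejn => esym (pd j lejn)).
pose g : chain_map Y X := @ChainMap k C n A B A B Y X q dq.
exists Y; split=> //; exists f, g; split.
- by split; rewrite /= ?mcompm1 ?mcomp1m /p ?p0E ?pnE eqm_comp;
    [congr eqm | congr eqm]; exact: Prop_irrelevance.
- by split; rewrite /= ?mcompm1 ?mcomp1m /q ?q0E ?qnE eqm_comp;
    [congr eqm | congr eqm]; exact: Prop_irrelevance.
- exists H; split=> [|j ltjn|]; rewrite ?H0 ?Hn ?mcomp0m ?mcompm0 //.
  exact: HE.
exists (fun=> 0); split=> [|j ltjn|]; rewrite ?mcomp0m ?mcompm0 //.
by rewrite addr0 -[X in _ - X]/(p j.+1 ∘ q j.+1) pq subrr.
Qed.

End Homotopy.

Section RadicalRealization.
Variables (k : comPzRingType) (C : addcat k) (n : nat) (A B : C).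

(** Gaussian elimination.  Since [d_i] is not radical, some [g ∘ d_i ∘ s] is the
    identity of a local object [D].  With [h := s ∘ g] the idempotents
    [h ∘ d_i] of [X_i] and [d_i ∘ h] of [X_{i+1}] both have image [D] and form
    the boundary of [h]; passing to complements removes one local summand from
    each of the two terms. *)
Lemma cancel_local_summand (X : cplx n A B) (m : nat -> nat) i :
  (0 < i < n)%N -> (forall j, local_sum (m j) (X j)) -> ~ rad (cdiff X i) ->
  exists (Y : cplx n A B) (m' : nat -> nat),
    [/\ homotopy_equivalent X Y, forall j, local_sum (m' j) (Y j),
        forall j, (m' j <= m j)%N & (m' i < m i)%N].
Proof.
move=> /andP [i_gt0 ltin] sX /(nonrad_local_summand (sX i)).
move=> [D [s [g [locD gds]]]].
have gds' : g ∘ (cdiff X i ∘ s) = idm D by rewrite mcompA.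
have [mi [M [q [p [miE sM [_ pq sumM]]]]]] := local_exchange (sX i) locD gds.
have [mi1 [N [q' [p' [mi1E sN [_ pq' sumN]]]]]] :=
  local_exchange (sX i.+1) locD gds'.
pose S := dfwith (dfwith (fun j => full_retract (X j)) (Retract pq))
  (Retract pq').
pose H := dfwith (fun j => 0 : mor (X j.+1) (X j)) (s ∘ g).
have Si : S i = Retract pq.
  by rewrite /S dfwith_out ?dfwith_in // neq_ltn leqnn orbT.
have Si1 : S i.+1 = Retract pq' by rewrite /S dfwith_in.
have Sout j : j != i -> j != i.+1 -> S j = full_retract (X j).
  by move=> ji ji1; rewrite /S !dfwith_out // eq_sym.
have Hi : H i = s ∘ g by rewrite /H dfwith_in.
have Hout j : j != i -> H j = 0 by move=> ji; rewrite /H dfwith_out // eq_sym.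
have [|||||Y [XY YE]] := deformation_retract (S := S) (H := H).
- by apply: Sout; rewrite neq_ltn // i_gt0.
- by apply: Sout; rewrite ?eqSS neq_ltn ?ltin ?orbT // (ltn_trans ltin) ?orbT.
- by apply: Hout; rewrite neq_ltn i_gt0.
- by apply: Hout; rewrite neq_ltn ltin orbT.
- move=> j ltjn; have [ji|nji] := eqVneq j i.
    subst j; rewrite Si1 Hi Hout ?mcomp0m ?addr0; last first.
      by rewrite neq_ltn leqnn orbT.
    by rewrite /= -sumN addrK mcompA.
  have [ji|nj1i] := eqVneq j.+1 i.
    subst i; rewrite Si Hi Hout // mcompm0 add0r /= -sumM addrK.
    by rewrite mcompA.
  rewrite Sout ?eqSS // !Hout // mcompm0 mcomp0m addr0 /= mcomp1m subrr.
  by [].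
exists Y, (fun j => if j == i then mi else if j == i.+1 then mi1 else m j).
split=> // [j|j|]; last by rewrite eqxx miE.
  rewrite YE; have [->|nji] := eqVneq j i; first by rewrite Si.
  by have [->|nji1] := eqVneq j i.+1; [rewrite Si1 | rewrite Sout].
have [->|_] := eqVneq j i; first by rewrite miE.
by have [->|//] := eqVneq; rewrite mi1E.
Qed.

(** Cancellation lowers the number of local summands in the middle terms. *)
Lemma radical_representative (X : cplx n A B) : krull_schmidt C ->
  exists Y, homotopy_equivalent X Y /\
    forall i, (0 < i < n)%N -> rad (cdiff Y i).
Proof.
move=> ksC; have [m sX] := choice (fun j => krull_schmidt_local_sum ksC (X j)).
have [N] := ubnP (\sum_(j < n) m j)%N.
elim: N => // N IHN in X m sX *; rewrite ltnS => mN.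
have [radX|] := EM (forall i, (0 < i < n)%N -> rad (cdiff X i)).
  by exists X; split=> //; exact: homotopy_equivalent_refl.
move=> /existsNP [i /not_implyP [i_mid nrad]].
have [Y [m' [XY sY m'm m'i]]] := cancel_local_summand i_mid sX nrad.
have [|Z [YZ radZ]] := IHN Y m' sY.
  apply: leq_trans mN; have /andP [_ ltin] := i_mid.
  rewrite [ltnLHS](bigD1 (Ordinal ltin)) //= [ltnRHS](bigD1 (Ordinal ltin)) //=.
  by rewrite -addSn leq_add // leq_sum.
by exists Z; split=> //; exact: homotopy_equivalent_trans XY YZ.
Qed.

End RadicalRealization.

(** * Extensions and almost vanishing *)

Section Bifunctor.
Variables (k : comPzRingType) (C : lincat k) (E : bifunctor C).
Implicit Types (A B X Y Z : C).

Lemma pushD X A B (a : mor A B) (x y : E X A) :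
  push E a (x + y) = push E a x + push E a y.
Proof. by have := push_linear a 1 x y; rewrite !scale1r. Qed.

Lemma push0 X A B (a : mor A B) : push E a (0 : E X A) = 0.
Proof. by apply: (addrI (push E a 0)); rewrite -pushD !addr0. Qed.

Lemma pullD X Y A (c : mor Y X) (x y : E X A) :
  pull E c (x + y) = pull E c x + pull E c y.
Proof. by have := pull_linear c 1 x y; rewrite !scale1r. Qed.

Lemma pull0 X Y A (c : mor Y X) : pull E c (0 : E X A) = 0.
Proof. by apply: (addrI (pull E c 0)); rewrite -pullD !addr0. Qed.

Lemma push_morD X A B (a b : mor A B) (x : E X A) :
  push E (a + b) x = push E a x + push E b x.
Proof. by have := push_linearl x 1 a b; rewrite !scale1r. Qed.

Lemma push_mor0 X A B (x : E X A) : push E (0 : mor A B) x = 0.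
Proof.
by apply: (addrI (push E (0 : mor A B) x)); rewrite -push_morD !addr0.
Qed.

Lemma push_morB X A B (a b : mor A B) (x : E X A) :
  push E (a - b) x = push E a x - push E b x.
Proof. by apply/eqP; rewrite eq_sym subr_eq -push_morD subrK. Qed.

Lemma pull_morD X Y A (c d : mor Y X) (x : E X A) :
  pull E (c + d) x = pull E c x + pull E d x.
Proof. by have := pull_linearl x 1 c d; rewrite !scale1r. Qed.

Lemma pull_mor0 X Y A (x : E X A) : pull E (0 : mor Y X) x = 0.
Proof.
by apply: (addrI (pull E (0 : mor Y X) x)); rewrite -pull_morD !addr0.
Qed.

Lemma pull_morB X Y A (c d : mor Y X) (x : E X A) :
  pull E (c - d) x = pull E c x - pull E d x.
Proof. by apply/eqP; rewrite eq_sym subr_eq -pull_morD subrK. Qed.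

Lemma push_fix_eq0 X A (a : mor A A) (x : E X A) :
  push E a x = x -> is_iso (idm A - a) -> x = 0.
Proof.
move=> ax [b [bE _]]; rewrite -(push_id x) -bE push_comp push_morB push_id ax.
by rewrite subrr push0.
Qed.

Lemma pull_fix_eq0 X A (c : mor X X) (x : E X A) :
  pull E c x = x -> is_iso (idm X - c) -> x = 0.
Proof.
move=> cx [b [_ bE]]; rewrite -(pull_id x) -bE pull_comp pull_morB pull_id cx.
by rewrite subrr pull0.
Qed.

(** The extensions of Auslander-Reiten exangles, seen from the right and from
    the left end term. *)
Definition right_almost_vanishing X A (x : E X A) : Prop :=
  x <> 0 /\ forall Y (h : mor Y X), rad h -> pull E h x = 0.

Definition left_almost_vanishing X A (x : E X A) : Prop :=
  x <> 0 /\ forall B (h : mor A B), rad h -> push E h x = 0.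

Lemma nonzero_on_local_summand m X A (x : E X A) : local_sum m A -> x <> 0 ->
  exists B (r : mor A B), local_end B /\ push E r x <> 0.
Proof.
elim: m A x => [|m IHm] A x /=.
  by move=> A0 []; rewrite -(push_id x) A0 push_mor0.
move=> [B [A' [s [r [i [p [locB [_ _ sum] sA']]]]]]] x0.
have [rx|] := EM (push E r x = 0); last by exists B, r.
have [|D [r' [locD r'px]]] := IHm A' (push E p x) sA'.
  move=> px; apply: x0; rewrite -(push_id x) -sum push_morD !push_comp rx px.
  by rewrite !push0 addr0.
by exists D, (r' ∘ p); rewrite push_comp.
Qed.

End Bifunctor.

Section Socle.
Variables (k : comPzRingType) (k_artinian : artinian k).
Variables (C : lincat k) (E : bifunctor C) (E_finite : ext_finite E).
Implicit Types (A Y X K : C).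

Let E_dcc X A : chain_cond (E X A) true.
Proof. exact: chain_cond_fin_gen (artinian_dcc k_artinian) (E_finite X A). Qed.

Lemma pull_orbit_submodule X Y A (x : E Y A) :
  submodule (fun y => exists e : mor X Y, y = pull E e x).
Proof.
split=> [|a _ _ [e ->] [f ->]]; first by exists 0; rewrite pull_mor0.
by exists (a *: e + f); rewrite (pull_linearl x a e f).
Qed.

Lemma push_orbit_submodule X A B (x : E X A) :
  submodule (fun y => exists e : mor A B, y = push E e x).
Proof.
split=> [|a _ _ [e ->] [f ->]]; first by exists 0; rewrite push_mor0.
by exists (a *: e + f); rewrite (push_linearl x a e f).
Qed.

(** Choose [f] such that [f^* y] is nonzero and generates a cyclic
    [End(X)]-submodule of [E(X, A)] that is minimal.  If a radical [r] did not
    kill this generator, then [r^* f^* y] would generate the same submodule, and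
    the generator would be fixed by some [r ∘ e] although [1 - r ∘ e] is
    invertible. *)
Lemma right_socle X Y A (y : E Y A) (f0 : mor X Y) : pull E f0 y <> 0 ->
  exists f : mor X Y, pull E f y <> 0 /\
    forall r : mor X X, rad r -> pull E (f ∘ r) y = 0.
Proof.
move=> f0y.
pose F N := exists2 f : mor X Y, pull E f y <> 0 &
  N = fun z => exists e : mor X X, z = pull E e (pull E f y).
have [||_ [[f fy ->] fmin]] := chain_cond_extremal (@E_dcc X A) (F := F).
- by move=> _ [f _ ->]; exact: pull_orbit_submodule.
- by exists (fun z => exists e : mor X X, z = pull E e (pull E f0 y)), f0.
exists f; split=> // r radr; apply: contrapT => fry.
have [|z [e ->]|_] :=
  fmin (fun z => exists e : mor X X, z = pull E e (pull E (f ∘ r) y)) _ _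
    (pull E f y).
- by exists (f ∘ r).
- by exists (r ∘ e); rewrite !pull_comp.
case=> [|e]; first by exists (idm X); rewrite pull_id.
rewrite pull_comp -pull_comp => fyE; apply: fy.
apply: pull_fix_eq0 (esym fyE) _.
exact: rad_iso_1Br.
Qed.

Lemma left_socle X A K (x : E X A) (h0 : mor A K) : push E h0 x <> 0 ->
  exists h : mor A K, push E h x <> 0 /\
    forall r : mor K K, rad r -> push E (r ∘ h) x = 0.
Proof.
move=> h0x.
pose F N := exists2 h : mor A K, push E h x <> 0 &
  N = fun z => exists e : mor K K, z = push E e (push E h x).
have [||_ [[h hx ->] hmin]] := chain_cond_extremal (@E_dcc X K) (F := F).
- by move=> _ [h _ ->]; exact: push_orbit_submodule.
- by exists (fun z => exists e : mor K K, z = push E e (push E h0 x)), h0.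
exists h; split=> // r radr; apply: contrapT => rhx.
have [|z [e ->]|_] :=
  hmin (fun z => exists e : mor K K, z = push E e (push E (r ∘ h) x)) _ _
    (push E h x).
- by exists (r ∘ h).
- by exists (e ∘ r); rewrite !push_comp.
case=> [|e]; first by exists (idm K); rewrite push_id.
rewrite push_comp -push_comp => hxE; apply: hx.
apply: push_fix_eq0 (esym hxE) _.
exact: radr.
Qed.

End Socle.

(** * Exact sequences of extensions and Auslander-Reiten exangles *)

Section ConeEnds.
Variables (k : comPzRingType) (C : addcat k).

Lemma last_diff_cone n (A B A' B' : C) (X : cplx n A B) (Y : cplx n A' B')
    (f : chain_map X Y) T (h : mor T (cone f n)) : (0 < n)%N ->
  exists u v,
    last_diff (cone f) ∘ h = eqm (cob_last Y) ∘ f n.+1 ∘ u + last_diff Y ∘ v.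
Proof.
case: n X Y f h => // n X Y f h _.
suff cone_last_row (e : cone_ob X Y n.+2 = B') (g : mor T (cone_ob X Y n.+1)) :
    exists u v, eqm e ∘ cone_diff f n.+1 ∘ g =
      eqm (cob_last Y) ∘ f n.+2 ∘ u + last_diff Y ∘ v.
  exact: (cone_last_row (cone_last X Y) h).
move: e g; rewrite /cone_diff /cone_ob.
case: (n =P n.+1) => [nn|_]; first by have := ltnn n; rewrite {2}nn ltnS leqnn.
case: (n.+1 =P n.+1) => // _ e g; exists (pr1 ∘ g), (pr2 ∘ g).
rewrite (Prop_irrelevance e (cob_last Y)) /last_diff /rowm.
by rewrite -!mcompA -mcompDr mcompDl !mcompA.
Qed.

Lemma first_diff_cocone n (A B A' B' : C) (X : cplx n A B) (Y : cplx n A' B')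
    (f : chain_map X Y) T (h : mor (cocone f 1%N) T) : (0 < n)%N ->
  exists u v, h ∘ first_diff (cocone f) =
    u ∘ f 0%N ∘ eqm (esym (cob_first X)) + v ∘ first_diff X.
Proof.
move=> n_gt0.
suff cocone_first_col (g : mor (cocone_ob X Y 1%N) T) : exists u v,
    g ∘ (cocone_diff f 0%N ∘ eqm (esym (cob_first X))) =
    u ∘ f 0%N ∘ eqm (esym (cob_first X)) + v ∘ first_diff X.
  exact: (cocone_first_col h).
move: g; rewrite /cocone_diff /cocone_ob.
case: (0%N =P n) => [n0|_]; first by rewrite -n0 in n_gt0.
move=> g; exists (g ∘ in1), (g ∘ in2).
by rewrite /first_diff /colm mcompA mcompDr mcompDl !mcompA.
Qed.

End ConeEnds.

Section ExangulatedCategory.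
Variables (k : comPzRingType) (n : nat) (n_gt0 : (0 < n)%N).
Variables (C : addcat k) (E : bifunctor C) (s : realization n E).
Hypothesis (C_exangulated : exangulated s n_gt0).
Implicit Types (A B F L T : C).

Let s_exact : exact_realization s n_gt0 :=
  exangulated_realization C_exangulated.

Lemma realization_exists A B (x : E B A) : exists X, distinguished s x X.
Proof.
have [X sX] := realization_class s_exact x.
by exists X; apply/sX; exact: homotopy_equivalent_refl.
Qed.

Lemma distinguished_homotopy A B (x : E B A) (X Y : cplx n A B) :
  distinguished s x X -> homotopy_equivalent X Y -> distinguished s x Y.
Proof.
have [X0 sX0] := realization_class s_exact x.
move=> /sX0 X0X XY; apply/sX0; exact: homotopy_equivalent_trans X0X XY.
Qed.

Section Distinguished.
Variables (A B : C) (x : E B A) (X : cplx n A B).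
Hypothesis (sX : distinguished s x X).

Let X_exangle : exangle X x := realization_exangle s_exact sX.

Lemma pull_eq0 T (g : mor T B) : pull E g x = 0 <-> factors g (last_diff X).
Proof. by case: X_exangle => /(_ T) [_ h] _; exact: h. Qed.

Lemma push_eq0 T (g : mor A T) : push E g x = 0 <-> cofactors g (first_diff X).
Proof. by case: X_exangle => _ /(_ T) [_ h]; exact: h. Qed.

Lemma pull_last_diff : pull E (last_diff X) x = 0.
Proof. by apply/pull_eq0; exists (idm _); rewrite mcompm1. Qed.

Lemma push_first_diff : push E (first_diff X) x = 0.
Proof. by apply/push_eq0; exists (idm _); rewrite mcomp1m. Qed.

Lemma split_epi_last_diff : split_epi (last_diff X) <-> x = 0.
Proof.
rewrite -(pull_id x); split=> [[g gE]|/pull_eq0 [g gE]]; last by exists g.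
by apply/pull_eq0; exists g.
Qed.

Lemma split_mono_first_diff : split_mono (first_diff X) <-> x = 0.
Proof.
rewrite -(push_id x); split=> [[g gE]|/push_eq0 [g gE]]; last by exists g.
by apply/push_eq0; exists g.
Qed.

End Distinguished.

(** Exactness of [C(F, B) -> E(F, A) -> E(F, X_1)].  The extension [rho] of
    [B ⊕ F] by [A] with components [x] and [th] restricts to [x] on [B]; the
    cone of a lift of that inclusion realizes [(d_0)_* rho = 0], so its last
    differential, a row with entries [in1] and the last differential of [rho],
    splits.  A section expresses [in2] through [in1] and a morphism that
    kills [rho]. *)
Lemma push_first_diff_exact A B (x : E B A) (X : cplx n A B) F (th : E F A) :
  distinguished s x X -> push E (first_diff X) th = 0 ->
  exists c : mor F B, th = pull E c x.
Proof.
move=> sX dth.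
pose rho := pull E pr1 x + pull E pr2 th : E (B ⊕ F) A.
have rho1 : pull E in1 rho = x.
  by rewrite pullD -!pull_comp pr1_in1 pr2_in1 pull_id pull_mor0 addr0.
have rho2 : pull E in2 rho = th.
  by rewrite pullD -!pull_comp pr1_in2 pr2_in2 pull_id pull_mor0 add0r.
have [Q sQ] := realization_exists rho.
have sX' : distinguished s (pull E in1 rho) X by rewrite rho1.
have [f [[_ fn] sf]] := exangulated_cone C_exangulated sX' sQ.
have [h hE] : split_epi (last_diff (cone f)).
  apply/(split_epi_last_diff sf).
  by rewrite pushD !push_pull dth (push_first_diff sX) !pull0 addr0.
have [u [v]] := last_diff_cone h n_gt0.
rewrite hE fn -mcompA => idE.
exists (eqm (cob_last X) ∘ u ∘ in2).
have in2E : in2 = in1 ∘ (eqm (cob_last X) ∘ u ∘ in2) +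
    last_diff Q ∘ (v ∘ in2).
  by rewrite -{1}[in2]mcomp1m idE mcompDl (mcompA (last_diff Q)) !mcompA.
rewrite -rho2 [in LHS]in2E pull_morD (pull_comp in1) rho1.
by rewrite (pull_comp (last_diff Q)) (pull_last_diff sQ) pull0 addr0.
Qed.

(** Exactness of [C(A, F) -> E(B, F) -> E(X_n, F)], by the dual argument: the
    cocone realizes [d_n^* rho = 0], and its first differential is a column with
    entries [pr1] and the first differential of [rho]. *)
Lemma pull_last_diff_exact A B (x : E B A) (X : cplx n A B) F (th : E B F) :
  distinguished s x X -> pull E (last_diff X) th = 0 ->
  exists a : mor A F, th = push E a x.
Proof.
move=> sX dth.
pose rho := push E in1 x + push E in2 th : E B (A ⊕ F).
have rho1 : push E pr1 rho = x.
  by rewrite pushD -!push_comp pr1_in1 pr1_in2 push_id push_mor0 addr0.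
have rho2 : push E pr2 rho = th.
  by rewrite pushD -!push_comp pr2_in1 pr2_in2 push_id push_mor0 add0r.
have [Q sQ] := realization_exists rho.
have sX' : distinguished s (push E pr1 rho) X by rewrite rho1.
have [f [[f0 _] sf]] := exangulated_cocone C_exangulated sQ sX'.
have [h hE] : split_mono (first_diff (cocone f)).
  apply/(split_mono_first_diff sf).
  by rewrite pullD -!push_pull dth (pull_last_diff sX) !push0 addr0.
have [u [v]] := first_diff_cocone h n_gt0.
rewrite hE -mcompA f0 mcompA => idE.
exists (pr2 ∘ (u ∘ eqm (esym (cob_first X)))).
have pr2E : pr2 = pr2 ∘ (u ∘ eqm (esym (cob_first X))) ∘ pr1 +
    pr2 ∘ v ∘ first_diff Q.
  by rewrite -{1}[pr2]mcompm1 idE mcompDr (mcompA pr2 v) !mcompA.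
rewrite -rho2 [in LHS]pr2E push_morD (push_comp _ pr1) rho1.
by rewrite (push_comp _ (first_diff Q)) (push_first_diff sQ) push0 addr0.
Qed.

(** If [g_* x] were nonzero, the last differential of its realization would not
    split, hence be radical and kill [x].  By exactness [x = a_* g_* x] for some
    [a], which is absurd as [1 - a ∘ g] is invertible. *)
Lemma left_of_right_almost_vanishing A B (x : E B A) :
  local_end B -> right_almost_vanishing x -> left_almost_vanishing x.
Proof.
move=> locB [x0 xrad]; split=> // L g radg; apply: contrapT => gx.
have [Y sY] := realization_exists (push E g x).
have /xrad/(pull_last_diff_exact sY) [a aE] : rad (last_diff Y).
  by apply: local_rad_epi => // /(split_epi_last_diff sY).
apply: x0; apply: (push_fix_eq0 (a := a ∘ g)); last exact: radg.
by rewrite push_comp -aE.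
Qed.

Lemma right_of_left_almost_vanishing A B (x : E B A) :
  local_end A -> left_almost_vanishing x -> right_almost_vanishing x.
Proof.
move=> locA [x0 xrad]; split=> // L h radh; apply: contrapT => hx.
have [Y sY] := realization_exists (pull E h x).
have /xrad/(push_first_diff_exact sY) [c cE] : rad (first_diff Y).
  by apply: local_rad_mono => // /(split_mono_first_diff sY).
apply: x0; apply: (pull_fix_eq0 (c := h ∘ c)); last exact: rad_iso_1Br.
by rewrite pull_comp -cE.
Qed.

(** Morphisms that do not split off a local object are radical, so the almost
    split ends express almost vanishing on the two sides. *)
Lemma AR_exangle_exists A B (x : E B A) : krull_schmidt C ->
  local_end A -> local_end B ->
  right_almost_vanishing x -> left_almost_vanishing x ->
  exists X, AR_exangle s x X.
Proof.
move=> ksC locA locB [x0 xr] [_ xl]; have [X0 sX0] := realization_exists x.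
have [X [X0X radX]] := radical_representative X0 ksC.
have sX := distinguished_homotopy sX0 X0X; exists X; split=> //.
- split=> [/(split_mono_first_diff sX)//|L g ng].
  by apply/(push_eq0 sX); apply: xl; exact: local_rad_mono.
- split=> [/(split_epi_last_diff sX)//|L g ng].
  by apply/(pull_eq0 sX); apply: xr; exact: local_rad_epi.
Qed.

Lemma AR_exangle_of_right A B (x : E B A) : krull_schmidt C ->
  local_end B -> right_almost_vanishing x ->
  exists A' (x' : E B A') X, AR_exangle s x' X.
Proof.
move=> ksC locB [x0 xr]; have [m sA] := krull_schmidt_local_sum ksC A.
have [D [r [locD rx0]]] := nonzero_on_local_summand sA x0.
have rv : right_almost_vanishing (push E r x).
  by split=> // Y h radh; rewrite -push_pull xr // push0.
have [X ARX] := AR_exangle_exists ksC locD locB rv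
  (left_of_right_almost_vanishing locB rv).
by exists D, (push E r x), X.
Qed.

Lemma AR_exangle_of_left A B (x : E B A) : krull_schmidt C ->
  local_end B -> left_almost_vanishing x ->
  exists A' (x' : E B A') X, AR_exangle s x' X.
Proof.
move=> ksC locB [x0 xl]; have [m sA] := krull_schmidt_local_sum ksC A.
have [D [r [locD rx0]]] := nonzero_on_local_summand sA x0.
have lv : left_almost_vanishing (push E r x).
  by split=> // L h radh; rewrite -push_comp xl //; exact: rad_compr.
have [X ARX] := AR_exangle_exists ksC locD locB
  (right_of_left_almost_vanishing locD lv) lv.
by exists D, (push E r x), X.
Qed.

Lemma AR_exangle_nonzero A B (x : E B A) X : AR_exangle s x X -> x <> 0.
Proof. by move=> [sX [nm _] _ _] /(split_mono_first_diff sX). Qed.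

(** An endomorphism [g] of [X_1] fixing [d_0] has the form [1 - h d_1], and
    [d_1] is radical. *)
Lemma AR_exangle_left_minimal A B (x : E B A) X :
  local_end B -> AR_exangle s x X -> left_minimal (first_diff X).
Proof.
move=> locB [sX _ [nepi _] radX] g gd.
have radn : rad (cdiff X n).
  have -> : cdiff X n = eqm (esym (cob_last X)) ∘ last_diff X.
    by rewrite mcompA eqmK mcomp1m.
  by apply: rad_compl; exact: local_rad_epi.
have rad1 : rad (cdiff X 1%N).
  have [n1|n1|n1] := ltngtP 1%N n; first exact: radX.
    by move: n1; rewrite ltnNge n_gt0.
  by case: _ / (esym n1) in radn *.
have [_ /(_ (X 1%N)) [Xex _]] := realization_exangle s_exact sX.
have [|h hE] := (Xex 0%N (idm _ - g) n_gt0).1.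
  have : (idm _ - g) ∘ first_diff X = 0 by rewrite mcompBl mcomp1m gd subrr.
  move/(congr1 (fun f => f ∘ eqm (cob_first X))).
  by rewrite mcomp0m /first_diff -!mcompA eqmK mcompm1.
by rewrite -[g](subKr (idm _)) hE; exact: rad1.
Qed.

Lemma almost_factors_vanishing A B (x : E B A) X Y (f : mor Y B) :
  distinguished s x X -> almost_factors f (last_diff X) ->
  right_almost_vanishing (pull E f x).
Proof.
move=> sX [nf fr]; split=> [/(pull_eq0 sX)//|T h radh].
by rewrite -pull_comp; apply/(pull_eq0 sX); exact: fr.
Qed.

Section Socles.
Hypotheses (k_artinian : artinian k) (E_finite : ext_finite E).

(** Some [f0 : Y -> B] does not factor, since otherwise determinedness would
    make the identity of [B] factor.  Some [f] gives a socle element, killed by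
    the radical endomorphisms of [Y], and determinedness extends this from [Y]
    to arbitrary sources. *)
Lemma right_determined_almost_factors A B (x : E B A) X Y :
  distinguished s x X -> ~ split_epi (last_diff X) ->
  right_determined (last_diff X) Y ->
  exists f : mor Y B, almost_factors f (last_diff X).
Proof.
move=> sX nepi det.
have [f0 nf0] : exists f0 : mor Y B, ~ factors f0 (last_diff X).
  apply: contrapT => nex; apply: nepi.
  have [|u uE] := det B (idm B); last by exists u.
  by move=> h; rewrite mcomp1m; apply: contrapT => nh; apply: nex; exists h.
have [|f [fx frad]] := right_socle k_artinian E_finite (y := x) (f0 := f0).
  by move/(pull_eq0 sX).
exists f; split=> [/(pull_eq0 sX)//|T h radh]; apply: det => u.
rewrite -mcompA; apply/(pull_eq0 sX); apply: frad; exact: rad_compr.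
Qed.

Lemma left_determined_vanishing A B (x : E B A) X K :
  distinguished s x X -> ~ split_mono (first_diff X) ->
  left_determined (first_diff X) K ->
  exists h : mor A K, left_almost_vanishing (push E h x).
Proof.
move=> sX nmono det.
have [h0 nh0] : exists h0 : mor A K, ~ cofactors h0 (first_diff X).
  apply: contrapT => nex; apply: nmono.
  have [|u uE] := det A (idm A); last by exists u.
  by move=> h; rewrite mcompm1; apply: contrapT => nh; apply: nex; exists h.
have [|h [hx hrad]] := left_socle k_artinian E_finite (x := x) (h0 := h0).
  by move/(push_eq0 sX).
exists h; split=> // T g radg; rewrite -push_comp; apply/(push_eq0 sX).
apply: det => u; rewrite mcompA; apply/(push_eq0 sX); apply: hrad.
exact: rad_compl.
Qed.

End Socles.

Lemma right_almost_split_determined X B (f : mor X B) :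
  right_almost_split f -> right_determined f B.
Proof.
move=> [nf fall] L g gf; apply: fall => -[h gh].
have [u uE] := gf h; apply: nf; exists u; by rewrite -uE.
Qed.

Lemma left_almost_split_determined A X (f : mor A X) :
  left_almost_split f -> left_determined f A.
Proof.
move=> [nf fall] L g gf; apply: fall => -[h hg].
have [u uE] := gf h; apply: nf; exists u; by rewrite -uE.
Qed.

End ExangulatedCategory.

(** * Duality *)

Section DualizingForms.
Variables (k : comPzRingType) (J : lmodType k) (C : lincat k).
Variables (E : bifunctor C).

(** The form [gamma] is the image of [id_T] under an isomorphism between
    [C(-, T)] modulo injectively trivial morphisms and [D E(X, -)]. *)
Definition dualizes (X T : C) (gamma : {linear E X T -> J}) : Prop :=
  (forall Y (phi : {linear E X Y -> J}), exists f : mor Y T,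
     forall x, phi x = gamma (push E f x)) /\
  (forall Y (f : mor Y T), (forall x : E X Y, gamma (push E f x) = 0) ->
     inj_trivial E f).

(** Yoneda's lemma. *)
Lemma in_Cr_dualizes X :
  in_Cr J E X <-> exists T (gamma : {linear E X T -> J}), dualizes gamma.
Proof.
split=> [[T [eta [eta_bij eta_nat]]]|[T [gamma [gamma_surj gamma_inj]]]].
  have [inv etaK invK] := eta_bij T.
  pose gamma : hom_mod (E X T) J := inv (to_stable E (idm (T : C))).
  have eta_gamma (Y : C) (f : mor Y (T : C)) :
      eta Y (dual_ext_map J X (to_stable E f) gamma) = to_stable E f.
    transitivity (stable_comp (to_stable E (idm (T : C))) (to_stable E f)).
      by rewrite -[X in stable_comp X _]invK; exact: eta_nat.
    exact: (@stable_comp1m _ _ E Y T (to_stable E f)).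
  have gammaE (Y : C) (f : mor Y (T : C)) x :
      hom_mod_fun (dual_ext_map J X (to_stable E f) gamma) x =
      (gamma : {linear _ -> _}) (push E f x).
    by rewrite -(push_of_stable f x).
  exists T, gamma; split=> [Y phi|Y f f0].
    exists (of_stable (eta Y (phi : hom_mod _ _))) => x; rewrite -gammaE.
    rewrite -[LHS]/(hom_mod_fun phi x); congr (hom_mod_fun _ x).
    apply: (bij_inj (eta_bij Y)).
    by rewrite eta_gamma of_stableK.
  suff /to_stableP : to_stable E f = to_stable E 0 by rewrite subr0 => /injtP.
  rewrite -eta_gamma; have -> : dual_ext_map J X (to_stable E f) gamma = 0.
    by apply: hom_modP => x; rewrite gammaE f0.
  by rewrite linear0; apply/esym; have := linear0 (to_quot (injt_submod E Y T)).
pose eps Y (f : stable_hom E Y T) : hom_mod (E X Y) J :=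
  dual_ext_map J X (f : mor (Y : stable_cat E) T) (gamma : hom_mod _ _).
have epsE Y (f : stable_hom E Y T) x :
  hom_mod_fun (eps Y f) x = gamma (push E (of_stable f) x) by [].
have epsE' Y (f : mor Y T) x :
  hom_mod_fun (eps Y (to_stable E f)) x = gamma (push E f x).
  by rewrite epsE push_of_stable.
have eps_lin Y : linear (eps Y).
  move=> a f g; apply: hom_modP => x.
  rewrite -[f]of_stableK -[g]of_stableK -to_stable_linear.
  rewrite -[RHS]/(a *: hom_mod_fun (eps Y _) x + hom_mod_fun (eps Y _) x).
  by rewrite !epsE' (push_linearl x a) linearP.
have eps_inj Y : injective (eps Y).
  move=> f g; rewrite -[f]of_stableK -[g]of_stableK => fg.
  apply/to_stableP/injtP/gamma_inj => x.
  by rewrite push_morB linearB -!epsE' fg subrr.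
have eps_surj Y phi : exists f, eps Y f = phi.
  have [f fE] := gamma_surj Y phi; exists (to_stable E f).
  by apply: hom_modP => x; rewrite epsE' -fE.
pose eta Y := projT1 (choice (eps_surj Y)).
have etaK Y phi : eps Y (eta Y phi) = phi := projT2 (choice (eps_surj Y)) phi.
have epsK Y f : eta Y (eps Y f) = f by apply: eps_inj; rewrite etaK.
have eta_lin Y : linear (eta Y).
  by move=> a phi psi; apply: eps_inj; rewrite etaK eps_lin !etaK.
exists T, (fun Y => linear_of (@eta_lin Y)); split=> [Y|Y Z f phi] /=.
  by exists (eps Y).
apply: eps_inj; rewrite etaK -{1}[phi]etaK; apply: hom_modP => x.
rewrite -[f]of_stableK -[eta Z phi]of_stableK.
rewrite -[X in eps Y X]/(stable_comp _ _) stable_compE epsE'.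
rewrite push_comp -epsE' -(push_of_stable (of_stable f)).
by [].
Qed.

End DualizingForms.

Section Duality.
Variables (k : comPzRingType) (k_artinian : artinian k).
Variables (J : lmodType k) (J_min : minimal_injective_cogenerator J).
Variables (n : nat) (n_gt0 : (0 < n)%N).
Variables (C : addcat k) (E : bifunctor C) (s : realization n E).
Hypotheses (C_exangulated : exangulated s n_gt0) (E_finite : ext_finite E).
Implicit Types (A B T X Y Z : C).

(** Almost vanishing makes every extension reachable: a nonzero pushforward
    of an extension by [f] pulls back to [x], and every nonzero [z] in [E(B, Y)]
    is pushed to [x] by some [Y -> A].  Hence a form that does not vanish on
    [x] gives a pairing of [E(B, Y)] with [C(Y, A)] nondegenerate on both
    sides, and double annihilators do the rest. *)
Lemma AR_exangle_dualizes A B (x : E B A) (X : cplx n A B) :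
  AR_exangle s x X -> exists gamma : {linear E B A -> J}, dualizes gamma.
Proof.
move=> ARX; have x0 := AR_exangle_nonzero C_exangulated ARX.
have [sX [_ lsplit] [_ rsplit] _] := ARX.
have [[_ _ Jcog] _] := J_min.
have [gamma gammax] := cogenerator_separates Jcog (E_finite B A) x0.
exists gamma; split=> [Y phi|Y f f0 Z z]; last first.
  apply: contrapT => fz; apply: gammax.
  have [W sW] := realization_exists C_exangulated (push E f z).
  have [|u uE] := lsplit _ (first_diff W).
    by move/(split_mono_first_diff C_exangulated sW).
  have [|c ->] := push_first_diff_exact C_exangulated (th := x) sW.
    by rewrite uE push_comp (push_first_diff C_exangulated sX) push0.
  by rewrite -push_pull.
pose S (psi : hom_mod (E B Y) J) := exists f : mor Y A,
  forall z, hom_mod_fun psi z = gamma (push E f z).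
have sS : submodule S.
  split=> [|a psi1 psi2 [f1 psi1E] [f2 psi2E]].
    by exists 0 => z; rewrite push_mor0 linear0.
  exists (a *: f1 + f2) => z; rewrite (push_linearl z a f1 f2) linearP.
  by rewrite -psi1E -psi2E.
apply: (submodule_double_perp k_artinian J_min (E_finite B Y) sS) => z Sz.
suff -> : z = 0 by exact: linear0.
apply: contrapT => z0; apply: gammax.
have [W sW] := realization_exists C_exangulated z.
have [|u uE] := rsplit _ (last_diff W).
  by move/(split_epi_last_diff C_exangulated sW).
have [|a ->] := pull_last_diff_exact C_exangulated (th := x) sW.
  by rewrite uE pull_comp (pull_last_diff C_exangulated sX) pull0.
pose psi : hom_mod (E B Y) J := (gamma \o @push k C E B Y A a).
by have /Sz : S psi by exists a.
Qed.

Section Pairing.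
Variables (X T : C) (gamma : {linear E X T -> J}).
Hypothesis (gamma_dual : dualizes gamma).

(** If [y] is orthogonal to [C(X, Y)], then [gamma] vanishes on the kernel of
    [(d_0)_*] for a realization of [y], so it factors through [(d_0)_*]; by
    duality [d_0] has a retraction modulo injectively trivial morphisms. *)
Lemma orthogonal_to_morphisms Y (y : E Y T) :
  (forall h : mor X Y, gamma (pull E h y) = 0) -> y = 0.
Proof.
move=> hy; have [[_ Jinj _] _] := J_min; have [gsurj ginj] := gamma_dual.
have [W sW] := realization_exists C_exangulated y.
have [|g gE] := extend_linear (q := @push k C E X _ _ (first_diff W))
  (f := gamma) Jinj (E_finite _ _) (E_finite _ _).
  by move=> z /(push_first_diff_exact C_exangulated sW) [c ->].
have [f fE] := gsurj _ g.
have f_inj : inj_trivial E (idm T - f ∘ first_diff W).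
  apply: ginj => z; rewrite push_morB push_id push_comp linearB -gE fE.
  by rewrite subrr.
have /eqP := f_inj _ y; rewrite push_morB push_id push_comp.
by rewrite (push_first_diff C_exangulated sW) push0 subr0 => /eqP.
Qed.

Lemma orthogonal_to_extensions Y (h : mor X Y) :
  (forall y : E Y T, gamma (pull E h y) = 0) -> proj_trivial E h.
Proof.
move=> hy Z z; have [[_ _ Jcog] _] := J_min; have [gsurj _] := gamma_dual.
apply: contrapT => hz.
have [phi phiz] := cogenerator_separates Jcog (E_finite _ _) hz.
have [f fE] := gsurj _ phi; apply: phiz; by rewrite fE push_pull.
Qed.

Lemma extension_of_seq Y (ys : seq (E Y T)) : exists A (x : E Y A),
  forall L (g : mor L Y),
    pull E g x = 0 <-> forall y, y \in ys -> pull E g y = 0.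
Proof.
elim: ys => [|y ys [A [x xP]]].
  by exists zero_obj, 0 => L g; rewrite pull0; split=> // _ y; rewrite in_nil.
exists (T ⊕ A), (push E in1 y + push E in2 x) => L g.
rewrite pullD -!push_pull; split=> [gx|gys].
  have gy : pull E g y = 0.
    have := congr1 (push E pr1) gx.
    by rewrite pushD -!push_comp pr1_in1 pr1_in2 push_id push_mor0 addr0 push0.
  have /xP gys : pull E g x = 0.
    have := congr1 (push E pr2) gx.
    by rewrite pushD -!push_comp pr2_in1 pr2_in2 push_id push_mor0 add0r push0.
  by move=> z; rewrite inE => /orP [/eqP -> //|/gys].
rewrite gys ?mem_head // push0 add0r.
have -> : pull E g x = 0 by apply/xP => z zys; apply: gys; rewrite inE zys orbT.
exact: push0.
Qed.

(** Let [y_1, ..., y_m] generate the orthogonal [Hp] of [H] in [E(Y, T)], and let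
    [x] in [E(Y, T^m)] have these components.  A morphism factors through the
    last differential of a realization of [x] exactly when it kills all of [Hp].
    Extensions in [E(L, T)] vanish once all their pullbacks along [X -> L] are
    in the kernel of [gamma]; this gives determinedness and, for [L = X], shows
    that [H], being stable under [End(X)], kills [Hp].  Conversely what kills
    [Hp] lies in [H], which is its own double orthogonal because it contains
    the morphisms orthogonal to everything. *)
Lemma determined_deflation_exists Y (H : mor X Y -> Prop) :
  right_End_submodule H -> (forall f, proj_trivial E f -> H f) ->
  exists A (x : E Y A) (W : cplx n A Y),
    [/\ distinguished s x W, right_determined (last_diff W) X
      & forall h : mor X Y, H h <-> exists g, h = last_diff W ∘ g].
Proof.
move=> [H0 HB HE] HP.
have sH : submodule H.
  split=> // a f g Hf Hg.
  have -> : a *: f + g = f ∘ (a *: idm X) - (0 - g).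
    rewrite sub0r opprK; congr (_ + _).
    have := mcomp_linearr X f a (idm X) 0.
    by rewrite addr0 mcompm0 addr0 mcompm1.
  by apply: (HB) (HB _ _ H0 Hg); exact: HE.
pose Hp (y : E Y T) := forall h, H h -> gamma (pull E h y) = 0.
have sHp : submodule Hp.
  split=> [h _|a y z Hy Hz h Hh]; first by rewrite pull0 linear0.
  by rewrite (pull_linear h a y z) linearP Hy // Hz // scaler0 addr0.
have Hpp (h : mor X Y) : (forall y, Hp y -> gamma (pull E h y) = 0) -> H h.
  move=> hHp.
  pose form (f : mor X Y) : {linear E Y T -> J} :=
    linear_of (fun a y z => etrans (congr1 gamma (pull_linear f a y z))
      (linearP gamma a (pull E f y) (pull E f z))).
  pose S (psi : hom_mod (E Y T) J) := exists2 f, H f &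
    forall y, hom_mod_fun psi y = gamma (pull E f y).
  have sS : submodule S.
    split; first by exists 0 => // y; rewrite pull_mor0 linear0.
    move=> a psi1 psi2 [f1 Hf1 psi1E] [f2 Hf2 psi2E].
    exists (a *: f1 + f2) => [|y]; first by case: sH => _; apply.
    by rewrite (pull_linearl y a f1 f2) linearP -psi1E -psi2E.
  have [|f Hf fE] :=
      submodule_double_perp (phi := form h : hom_mod _ _) k_artinian J_min
        (E_finite Y T) sS.
    move=> y Sy; apply: hHp => f Hf.
    by have /Sy : S (form f : hom_mod _ _) by exists f.
  rewrite -(subrK f h); apply: (submoduleD sH) => //.
  apply/HP/orthogonal_to_extensions => y.
  by rewrite pull_morB linearB -fE subrr.
have [ys [ysHp Hpys]] :=
  fin_gen_submodule (fin_gen_acc k_artinian J_min (E_finite Y T)) sHp.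
have [A [x xP]] := extension_of_seq ys.
have [W sW] := realization_exists C_exangulated x.
exists A, x, W; split=> // [L g gdet|h].
  apply/(pull_eq0 C_exangulated sW)/xP => y yys.
  apply: orthogonal_to_morphisms => h; rewrite -pull_comp.
  have /(pull_eq0 C_exangulated sW)/xP -> // := gdet h.
  exact: linear0.
rewrite -[exists g, _]/(factors h (last_diff W)).
rewrite -(pull_eq0 C_exangulated sW) xP; split=> [Hh y /ysHp Hpy|hys].
  apply: orthogonal_to_morphisms => e; rewrite -pull_comp.
  by apply: Hpy; exact: HE.
apply: Hpp => y Hpy.
suff -> : pull E h y = 0 by exact: linear0.
move: (Hpys y Hpy); apply: (span_sub (N := fun z => pull E h z = 0)) => //.
split=> [|a z1 z2 hz1 hz2]; first exact: pull0.
by rewrite (pull_linear h a z1 z2) hz1 hz2 scaler0 addr0.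
Qed.

End Pairing.
End Duality.

(** * The equivalence *)

Theorem theorem1p1
  (k : comPzRingType) (k_artinian : artinian k)
  (J : lmodType k) (J_min : minimal_injective_cogenerator J)
  (n : nat) (n_gt0 : (0 < n)%N)
  (CC : addcat k) (E : bifunctor CC) (s : realization n E)
  (CC_exangulated : exangulated s n_gt0)
  (E_finite : ext_finite E)
  (CC_krull_schmidt : krull_schmidt CC)
  (CC_WIC : WIC s)
  (C : CC) (C_indec : indecomposable C) (C_nonproj : ~ projective s C) :
  [<->
    (* (1) *)
    in_Cr J E C;
    (* (2) *)
    forall (Y : CC) (H : mor C Y -> Prop),
      right_End_submodule H -> (forall f, proj_trivial E f -> H f) ->
      exists (A : CC) (x : E Y A) (X : cplx n A Y),
        [/\ distinguished s x X,
            right_determined (last_diff X) C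
          & forall h : mor C Y, H h <-> exists g, h = last_diff X ∘ g];
    (* (3); "~ split_mono a" is automatic for n = 1, but for n >= 2 the complex
       X0 = X0 -> 0 -> ... -> 0 -> C = C would make C an intrinsic weak
       cokernel of the identity of X0. *)
    exists (X0 X1 : CC) (a : mor X0 X1),
      [/\ inflation s a, ~ split_mono a, intrinsic_weak_cokernel s a C
        & exists K : CC, left_determined a K];
    (* (4) *)
    exists (A : CC) (x : E C A) (X : cplx n A C), AR_exangle s x X;
    (* (5) *)
    exists (Z Y : CC) (a : mor Z Y),
      [/\ deflation s a, ~ split_epi a & right_determined a C];
    (* (6) *)
    exists (Z Y : CC) (a : mor Z Y) (f : mor C Y),
      deflation s a /\ almost_factors f a].
Proof.
have C_local := indecomposable_local CC_krull_schmidt C_indec.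
have AR_of_6 : (exists (Z Y : CC) (a : mor Z Y) (f : mor C Y),
      deflation s a /\ almost_factors f a) ->
    exists (A : CC) (x : E C A) (X : cplx n A C), AR_exangle s x X.
  move=> [Z [Y [a [f [[A [y [X [sX aX]]]]]]]]]; case: _ / aX => afac.
  have rv := almost_factors_vanishing CC_exangulated sX afac.
  have h := AR_exangle_of_right CC_exangulated CC_krull_schmidt C_local rv.
  exact: h.
have six_of_5 : (exists (Z Y : CC) (a : mor Z Y),
      [/\ deflation s a, ~ split_epi a & right_determined a C]) ->
    exists (Z Y : CC) (a : mor Z Y) (f : mor C Y),
      deflation s a /\ almost_factors f a.
  move=> [Z [Y [a [[A [y [X [sX aX]]]]]]]]; case: _ / aX => nepi det.
  have [f ffac] := right_determined_almost_factors CC_exangulated k_artinian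
    E_finite sX nepi det.
  exists (X n), Y, (last_diff X), f; split=> //.
  by exists A, y, X.
have five_of_2 : (forall (Y : CC) (H : mor C Y -> Prop),
      right_End_submodule H -> (forall f, proj_trivial E f -> H f) ->
      exists (A : CC) (x : E Y A) (X : cplx n A Y),
        [/\ distinguished s x X,
            right_determined (last_diff X) C
          & forall h : mor C Y, H h <-> exists g, h = last_diff X ∘ g]) ->
    exists (Z Y : CC) (a : mor Z Y),
      [/\ deflation s a, ~ split_epi a & right_determined a C].
  (* For [H] take the projectively trivial endomorphisms: a splitting would make
     the identity of [C] one of them, and [C] projective. *)
  move=> two; have [||A [x [X [sX det XH]]]] := two C (@proj_trivial _ _ E C C).
  - split=> [Z z|f g fP gP Z z|f e fP Z z]; first exact: pull_mor0.
      by rewrite pull_morB fP gP subrr.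
    by rewrite pull_comp fP pull0.
  - by [].
  exists (X n), C, (last_diff X); split=> //; first by exists A, x, X.
  move=> [g gE]; apply: C_nonproj => A' B x' X' sX' p.
  apply/(pull_eq0 CC_exangulated sX'); rewrite -[LHS]pull_id.
  by have /XH -> : exists g', idm C = last_diff X ∘ g' by exists g.
have three_of_4 : (exists (A : CC) (x : E C A) (X : cplx n A C),
      AR_exangle s x X) ->
    exists (X0 X1 : CC) (a : mor X0 X1),
      [/\ inflation s a, ~ split_mono a, intrinsic_weak_cokernel s a C
        & exists K : CC, left_determined a K].
  move=> [A [x [X ARX]]]; have [sX lsplit _ _] := ARX.
  have infl : inflation s (first_diff X) by exists C, x, X.
  exists A, (X 1%N), (first_diff X); split=> //.
  - by case: lsplit.
  - split=> //; exists (X 1%N), (first_diff X); split; last by exists x, X.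
    split; first exact: (AR_exangle_left_minimal CC_exangulated C_local ARX).
      by exists (idm _); rewrite mcomp1m.
    by exists (idm _); rewrite mcomp1m.
  - by exists A; exact: left_almost_split_determined.
tfae.
- move=> /in_Cr_dualizes [T [gamma gdual]] Y H HE HP.
  exact: (determined_deflation_exists k_artinian J_min CC_exangulated E_finite
    gdual HE HP).
- by move=> /five_of_2/six_of_5/AR_of_6/three_of_4.
- (* The left minimal version inherits determinedness and does not split. *)
  move=> [X0 [X1 [a [_ nmono]]]].
  move=> [_ [Z1 [f' [[_ [u aE] [v f'E]]]]]] [x [X [sX fX]]] [K det].
  case: _ / fX in u v aE f'E.
  have nmono' : ~ split_mono (first_diff X).
    move=> [r rE]; apply: nmono; exists (r ∘ v).
    by rewrite -mcompA -f'E.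
  have det' : left_determined (first_diff X) K.
    move=> L g gdet; have [|w wE] := det L g.
      move=> h; have [w wE] := gdet h.
      by exists (w ∘ v); rewrite -mcompA -f'E.
    by exists (w ∘ u); rewrite -mcompA -aE.
  have [h lv] := left_determined_vanishing CC_exangulated k_artinian E_finite
    sX nmono' det'.
  have ARC := AR_exangle_of_left CC_exangulated CC_krull_schmidt C_local lv.
  exact: ARC.
- move=> [A [x [X [sX _ rsplit _]]]]; exists (X n), C, (last_diff X); split.
  + by exists A, x, X.
  + by case: rsplit.
  + exact: right_almost_split_determined.
- exact: six_of_5.
- move=> /AR_of_6 [A [x [X ARX]]]; apply/in_Cr_dualizes; exists A.
  exact: (AR_exangle_dualizes k_artinian J_min CC_exangulated E_finite ARX).
Qed.
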